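(* Consider the system $$\dot x_0=u_0,\quad \dot x_i=u_0x_{i+1}+\phi_i(t,u,x)\ (i=1,\dots,n-1),\quad \dot x_n=u+\phi_n(t,u,x),\quad y=[x_0,x_1]^{\mathrm T},$$ under Assumption 1. Let $T>0$, $\gamma_0=1/T$, $\gamma(t)=\frac{T}{T-t}\gamma_0$, and $\beta=\max\{\beta_1,\beta_2\}$ with $$\beta_1=8\sqrt2\, n d\Lambda\, cQ_nP_nQ_nc^{\mathrm T}+2\Big(2+\frac{\delta_c}{n}\Big),\qquad \beta_2=4\sqrt2\, d\Lambda+2\Big(2n+2-\frac1n\Big).$$ Apply $u_0(t)=-\frac{3}{T-t}x_0(t)-\frac{\beta}{2}(T-t)$ together with the observer-based output feedback $$\dot\xi(t)=\beta A\xi(t)+bu(t)+\beta Q(\gamma(t))c^{\mathrm T}\big(\gamma(t)^{n-1}x_1(t)-c\xi(t)\big),\qquad u(t)=-\beta b^{\mathrm T}P(\gamma(t))\xi(t),$$ with $\xi(t)\in\mathbf{R}^n$. Then there exist positive constants $\upsilon_3,\upsilon_{30},\upsilon_4,\upsilon_{40},\upsilon_5,\upsilon_{50}$ such that for any initial condition and all $t\in[0,T)$, $$|x_0(t)|\le (T-t)^2\Big(\frac{T-t}{T^3}|x_0(0)|+\frac{\beta t}{2T}\Big),\quad |u_0(t)|\le (T-t)\Big(3(T-t)\Big(\frac{|x_0(0)|}{T^3}+\frac{\beta}{2T}\Big)+\beta\Big),$$ $$\|x(t)\|\le \upsilon_3e^{\upsilon_{30}|x_0(0)|t}(T-t)^{3/2}(\|x(0)\|+\|\xi(0)\|),$$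 $$\|\xi(t)\|\le \upsilon_4e^{\upsilon_{40}|x_0(0)|t}(T-t)^{3/2}(\|x(0)\|+\|\xi(0)\|),$$ $$\|u(t)\|\le \upsilon_5e^{\upsilon_{50}|x_0(0)|t}(T-t)^{1/2}(\|x(0)\|+\|\xi(0)\|).$$
   Context: Assumption 1: $\phi_i$ are unknown continuous functions with $|\phi_i(t,u,x)|\le c_{i1}|x_1|+\cdots+c_{ii}|x_i|$, $c_{ij}\ge0$ known. $A$ is the $n\times n$ matrix with ones on the superdiagonal and zeros elsewhere, $b=[0,\dots,0,1]^{\mathrm T}$, $c=[1,0,\dots,0]$. For $\gamma>0$, $P(\gamma)$ is the unique positive definite solution of $A^{\mathrm T}P+PA-Pbb^{\mathrm T}P=-\gamma P$ and $Q(\gamma)$ is the unique positive definite solution of $AQ+QA^{\mathrm T}-Qc^{\mathrm T}cQ=-\gamma Q$; $P_n=P(1)$, $Q_n=Q(1)$, $\Lambda=\lambda_{\max}(P_n)$. $E_n=\mathrm{diag}\{n-1,\dots,1,0\}$, $\delta_c=n(1+\lambda_{\max}(E_n+P_nE_nP_n^{-1}))$. With $\gamma_0=1/T$, $g_{ij}=c_{ij}T^{i+1-j}$ ($j<i$), $g_{ii}=c_{ii}T+n-i$, and $d^2=\max_{j=1,\dots,n}\sum_{i=j}^n g_{ij}^2\, i\,\gamma_0^{-2(i-j)}$. *)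

(* Defs.v *)
From HB Require Import structures.
From mathcomp Require Import all_boot all_order all_algebra.
From mathcomp Require Import all_classical all_reals all_analysis.
Set Implicit Arguments. Unset Strict Implicit. Unset Printing Implicit Defensive.
Import Order.TTheory GRing.Theory Num.Theory.
Import numFieldNormedType.Exports.
Local Open Scope classical_set_scope.
Local Open Scope ring_scope.

Section Defs.
Variables (R : realType) (n : nat).

Definition Amat : 'M[R]_n := \matrix_(i, j) ((val j == (val i).+1)%:R).
Definition bvec : 'cV[R]_n := \col_i ((val i == n.-1)%:R).
Definition cvec : 'rV[R]_n := \row_j ((val j == 0%N)%:R).

Definition posdef (M : 'M[R]_n) : Prop :=
  M^T = M /\ forall v : 'cV[R]_n, v != 0 -> 0 < (v^T *m M *m v) ord0 ord0.

(* P(gamma): the (unique) positive definite solution of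
   A^T P + P A - P b b^T P = - gamma P *)
Definition Pmat (gamma : R) : 'M[R]_n :=
  xget 0 [set M | posdef M /\
    Amat^T *m M + M *m Amat - M *m bvec *m bvec^T *m M = - (gamma *: M)].

(* Q(gamma): the (unique) positive definite solution of
   A Q + Q A^T - Q c^T c Q = - gamma Q *)
Definition Qmat (gamma : R) : 'M[R]_n :=
  xget 0 [set M | posdef M /\
    Amat *m M + M *m Amat^T - M *m cvec^T *m cvec *m M = - (gamma *: M)].

Definition lambda_max (M : 'M[R]_n) : R := sup [set a : R | eigenvalue M a].

Definition Emat : 'M[R]_n := \matrix_(i, j) ((i == j)%:R * (n.-1 - val i)%:R).

Definition Pn := Pmat 1.
Definition Qn := Qmat 1.
Definition Lambda := lambda_max Pn.
Definition delta_c : R :=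
  n%:R * (1 + lambda_max (Emat + Pn *m Emat *m invmx Pn)).

Definition enorm (v : 'cV[R]_n) : R := Num.sqrt (\sum_i (v i ord0) ^+ 2).

(* g_{ij} (0-based indices: paper's g_{i+1,j+1}) *)
Definition gcoef (c : 'I_n -> 'I_n -> R) (T : R) (i j : 'I_n) : R :=
  if (val j < val i)%N then c i j * T ^+ (val i - val j).+1
  else if val j == val i then c i i * T + (n - (val i).+1)%:R
  else 0.

(* d = sqrt (max_j sum_{i >= j} g_ij^2 i gamma0^{-2(i-j)}), gamma0 = 1/T;
   paper's 1-based index i corresponds to (val i).+1 here *)
Definition dconst (c : 'I_n -> 'I_n -> R) (T : R) : R :=
  let gamma0 := T^-1 in
  Num.sqrt (\big[Num.max/0]_(j < n)
     \sum_(i < n | (val j <= val i)%N)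
        gcoef c T i j ^+ 2 * (val i).+1%:R * (gamma0^-1) ^+ (2 * (val i - val j))).

Definition beta1 (c : 'I_n -> 'I_n -> R) (T : R) : R :=
  8 * Num.sqrt 2 * n%:R * dconst c T * Lambda
    * (cvec *m Qn *m Pn *m Qn *m cvec^T) ord0 ord0
  + 2 * (2 + delta_c / n%:R).

Definition beta2 (c : 'I_n -> 'I_n -> R) (T : R) : R :=
  4 * Num.sqrt 2 * dconst c T * Lambda + 2 * (2 * n%:R + 2 - n%:R^-1).

Definition beta (c : 'I_n -> 'I_n -> R) (T : R) : R :=
  Num.max (beta1 c T) (beta2 c T).

End Defs.

(* Main.v *)
(* Put [g = 1 / (T - t)] and [L = diag(g^(n-1), ..., g, 1)].  In the scaled
   variables [w = L xi], [z = L^2 x], [e = z - w] the gains [P(g)], [Q(g)] become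
   the constant matrices [P], [Q], the closed loop becomes [g] times a fixed linear
   system with a lower triangular perturbation of size [d |z|], and the remaining
   part of [u0] only contributes [-3 a A z] with [a = x0(0) / T^3 + beta / (2 T)].
   For [W = w^T P w + kappa e^T Q^-1 e], [kappa = 2 c Q P Q c^T], the choice of
   [beta] gives [W' <= (-3 g + C |a|) W], hence [W = O((T - t)^3)] by Gronwall.
   The Riccati solutions are explicit: [Q = M^T M] with [M] the signed Pascal matrix,
   [M M = 1], and [P] is [Q] with rows and columns reversed; so [P], [Q] and their
   inverses all have the largest eigenvalue [Lambda]. *)

Require Import Defs.
From HB Require Import structures.
From mathcomp Require Import all_boot all_order all_algebra.
From mathcomp Require Import all_classical all_reals all_analysis.
From mathcomp Require Import ring lra zify.
Set Implicit Arguments. Unset Strict Implicit. Unset Printing Implicit Defensive.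
Import Order.TTheory GRing.Theory Num.Theory.
Import numFieldNormedType.Exports.
Local Open Scope classical_set_scope.
Local Open Scope ring_scope.

(** * Bilinear forms, definiteness and Rayleigh quotients *)

Section BilinearForms.
Variables (R : realType) (n : nat).
Implicit Types (M N S P : 'M[R]_n) (u v w : 'cV[R]_n) (a : R).

(** The two different powers of [L] come from the rates of the two chains. Since [L A = g A L], the
    observer chain, driven at the constant rate [beta], runs at rate [beta g] after one factor [L];
    the plant chain is driven by [u0], which is [beta / g] up to the term in [a], and needs two. The
    factor [g^(n-1)] on the measured output makes up for the difference. As [g' = g^2],
    differentiating [L] costs [g E L], once for [w] and twice for [z]. In the equation of [e] one
    copy becomes [E e]; the other, [E z], is counted in the perturbation, which is where [n - i] in
    the diagonal coefficient [g_ii] comes from. So [E] has to be bounded against [P], which is the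
    role of [delta_c], and against [Q^-1], where the explicit number [2 n - 1 - 1/n] needs an
    argument of its own. [Lambda] and [delta_c] are built on suprema of sets of eigenvalues, for
    [delta_c] those of a matrix that need not be symmetric. Both are turned into maxima of quotients
    of two quadratic forms. [P(g)] and [Q(g)] are given only by a description, so each explicit
    formula rests on a uniqueness proof. *)

Definition bf M u v : R := (u^T *m M *m v) ord0 ord0.

Lemma bfE M u v : bf M u v = \sum_i \sum_j M i j * u i ord0 * v j ord0.
Proof.
rewrite /bf mxE exchange_big; apply: eq_bigr => j _.
by rewrite mxE mulr_suml; apply: eq_bigr => i _; rewrite mxE (mulrC (M _ _)).
Qed.

Lemma bfDl M u v w : bf M (u + v) w = bf M u w + bf M v w.
Proof. by rewrite /bf raddfD /= !mulmxDl mxE. Qed.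
Lemma bfDr M u v w : bf M u (v + w) = bf M u v + bf M u w.
Proof. by rewrite /bf mulmxDr mxE. Qed.
Lemma bfZl M a u v : bf M (a *: u) v = a * bf M u v.
Proof. by rewrite /bf linearZ /= -!scalemxAl mxE. Qed.
Lemma bfZr M a u v : bf M u (a *: v) = a * bf M u v.
Proof. by rewrite /bf -scalemxAr mxE. Qed.
Lemma bfDm M N u v : bf (M + N) u v = bf M u v + bf N u v.
Proof. by rewrite /bf mulmxDr mulmxDl mxE. Qed.
Lemma bfZm M a u v : bf (a *: M) u v = a * bf M u v.
Proof. by rewrite /bf -scalemxAr -scalemxAl mxE. Qed.
Lemma bfNm M u v : bf (- M) u v = - bf M u v.
Proof. by rewrite /bf mulmxN mulNmx mxE. Qed.
Lemma bfNl M u v : bf M (- u) v = - bf M u v.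
Proof. by rewrite -scaleN1r bfZl mulN1r. Qed.
Lemma bfNr M u v : bf M u (- v) = - bf M u v.
Proof. by rewrite -scaleN1r bfZr mulN1r. Qed.
Lemma bf0l M v : bf M 0 v = 0.
Proof. by rewrite -(scale0r 0) bfZl mul0r. Qed.
Lemma bf_tr M u v : bf M^T u v = bf M v u.
Proof.
by rewrite /bf -[RHS]trace_mx11 -mxtrace_tr trace_mx11 !trmx_mul trmxK mulmxA.
Qed.
Lemma bfC M u v : M^T = M -> bf M u v = bf M v u.
Proof. by move=> {1}<-; rewrite bf_tr. Qed.
Lemma bfMr M N u v : bf (M *m N) u v = bf M u (N *m v).
Proof. by rewrite /bf !mulmxA. Qed.
Lemma bfMl M N u v : bf (M *m N) u v = bf N (M^T *m u) v.
Proof. by rewrite /bf trmx_mul trmxK !mulmxA. Qed.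

Lemma bf1E u v : bf 1%:M u v = \sum_i u i ord0 * v i ord0.
Proof. by rewrite /bf mulmx1 mxE; apply: eq_bigr => i _; rewrite mxE. Qed.

Definition psd M := M^T = M /\ forall v, 0 <= bf M v v.

Lemma posdef_psd M : posdef M -> psd M.
Proof.
move=> [sM pM]; split=> // v; have [->|/pM/ltW//] := eqVneq v 0.
by rewrite bf0l.
Qed.

Lemma posdef1 : posdef (1%:M : 'M[R]_n).
Proof.
split=> [|v v0]; first by rewrite trmx1.
rewrite -[X in 0 < X]/(bf 1%:M v v) bf1E.
have [i vi] : exists i, v i ord0 != 0.
  apply/existsP; apply: contraNT v0; rewrite negb_exists => /forallP v0.
  by apply/eqP/colP => i; rewrite mxE; apply/eqP; rewrite -[_ == _]negbK v0.
rewrite (bigD1 i) //= ltr_wpDr ?sumr_ge0//.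
  by move=> j _; rewrite -expr2 sqr_ge0.
by rewrite -expr2 exprn_even_gt0.
Qed.

Lemma psd_sqD M u v : psd M -> bf M (u + v) (u + v) <= 2 * (bf M u u + bf M v v).
Proof.
move=> [sM pM]; have := pM (u - v).
rewrite !(bfDl, bfDr, bfNl, bfNr) (bfC v u sM); lra.
Qed.

Lemma psd_young M u v a : psd M -> 0 < a ->
  2 * bf M u v <= a * bf M u u + a^-1 * bf M v v.
Proof.
move=> [sM pM] a0; have := pM (a *: u - v).
rewrite !(bfDl, bfDr, bfNl, bfNr, bfZl, bfZr) (bfC v u sM) => h.
rewrite -(ler_pM2l a0) mulrDr (mulrA a a^-1) divff ?gt_eqF//; lra.
Qed.

Lemma psd_CS M u v : psd M -> bf M u v ^+ 2 <= bf M u u * bf M v v.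
Proof.
move=> pM; have [sM M0] := pM.
have h s : 0 <= s ^+ 2 * bf M u u + 2 * s * bf M u v + bf M v v.
  by have := M0 (s *: u + v); rewrite !(bfDl, bfDr, bfZl, bfZr) (bfC v u sM); lra.
have := M0 u; rewrite le_eqVlt => /orP[/eqP a0|a0].
  rewrite -a0 mul0r; have [->|b0] := eqVneq (bf M u v) 0; first by rewrite expr0n.
  (* The leading coefficient vanishes, so the polynomial is affine in [s]; this [s] gives it the
     value [-1]. *)
  have := h (- (bf M v v + 1) / (2 * bf M u v)); rewrite -a0 mulr0 add0r.
  have -> : 2 * (- (bf M v v + 1) / (2 * bf M u v)) * bf M u v = - (bf M v v + 1).
    by field.
  lra.
have := h (- bf M u v / bf M u u).
have -> : (- bf M u v / bf M u u) ^+ 2 * bf M u u + 2 * (- bf M u v / bf M u u) * bf M u v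
   + bf M v v = (bf M u u * bf M v v - bf M u v ^+ 2) / bf M u u.
  by field; rewrite gt_eqF.
by rewrite pmulr_lge0 ?invr_gt0// subr_ge0.
Qed.

(** By Cauchy-Schwarz an isotropic vector of a semidefinite form is orthogonal to every vector. This
    stands in for differentiating a Rayleigh quotient at its maximiser. *)
Lemma psd_ker M v : psd M -> bf M v v = 0 -> v^T *m M = 0.
Proof.
move=> pM v0; apply/rowP => j; rewrite [RHS]mxE.
have /eqP : bf M v (delta_mx j ord0) = 0.
  have := psd_CS v (delta_mx j ord0) pM.
  by rewrite v0 mul0r le_eqVlt ltNge sqr_ge0 orbF sqrf_eq0 => /eqP.
by rewrite /bf -colE mxE => /eqP.
Qed.

Lemma posdef_unit P : posdef P -> P \in unitmx.
Proof.
move=> [sP pP]; rewrite -row_free_unit -kermx_eq0; apply/eqP/row_matrixP => i.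
rewrite row0; apply/eqP; apply: contraTT isT => k0.
have := pP (row i (kermx P))^T; rewrite trmxK -row_mul mulmx_ker row0 mul0mx mxE ltxx.
by apply; rewrite trmx_eq0.
Qed.

Lemma posdef_inv P : posdef P -> posdef (invmx P).
Proof.
move=> pP; have uP := posdef_unit pP; have [sP P0] := pP; split=> [|v v0].
  by rewrite trmx_inv sP.
have := P0 (invmx P *m v); rewrite trmx_mul trmx_inv sP mulmxKV// mulmxA; apply.
by apply: contra v0 => /eqP /(congr1 (mulmx P)); rewrite mulKVmx// mulmx0 => ->.
Qed.

Lemma continuous_sum (V : topologicalType) (I : Type) (r : seq I) (F : I -> V -> R) :
  (forall i, continuous (F i)) -> continuous (fun x => \sum_(i <- r) F i x).
Proof.
move=> cF; elim: r => [|i r IH] x.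
  by under eq_fun do rewrite big_nil; exact: cvg_cst.
under eq_fun do rewrite big_cons.
by apply: cvgD; [exact: cF|exact: IH].
Qed.

Lemma continuous_mul (V : topologicalType) (f g : V -> R) :
  continuous f -> continuous g -> continuous (fun x => f x * g x).
Proof. by move=> cf cg x; apply: cvgM; [exact: cf|exact: cg]. Qed.

Lemma continuous_div (V : topologicalType) (f g : V -> R) x :
  continuous f -> continuous g -> g x != 0 -> {for x, continuous (fun y => f y / g y)}.
Proof.
by move=> cf cg gx; apply: cvgM; [exact: cf|apply: cvgV => //; exact: cg].
Qed.

Lemma continuous_bf M : continuous (fun v : 'rV[R]_n => bf M v^T v^T).
Proof.
have -> : (fun v : 'rV[R]_n => bf M v^T v^T) =
    (fun v : 'rV[R]_n => \sum_i \sum_j M i j * v ord0 i * v ord0 j).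
  apply/funext => v; rewrite bfE; apply: eq_bigr => i _; apply: eq_bigr => j _.
  by rewrite !mxE.
apply: continuous_sum => i; apply: continuous_sum => j.
apply: continuous_mul; last exact: coord_continuous.
by apply: continuous_mul; [exact: cst_continuous|exact: coord_continuous].
Qed.

(** The quotient of the two forms is homogeneous of degree 0, so its maximum [m] is attained on the
    compact unit sphere. Then [m P - S] is semidefinite and vanishes at the maximiser, which
    therefore lies in its kernel. *)
Lemma rayleigh_max P S : (0 < n)%N -> posdef P -> S^T = S ->
  exists m v, [/\ v != 0, v^T *m S = m *: (v^T *m P) &
    forall w, bf S w w <= m * bf P w w].
Proof.
move=> n0 pP sS; have [sP P0] := pP.
pose A := [set v : 'rV[R]_n | `|v| = 1].
have A_neq0 (r : 'rV[R]_n) : A r -> r^T != 0.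
  move=> Ar; apply/eqP => /(congr1 trmx); rewrite trmxK trmx0 => r0.
  by move: Ar; rewrite /A /= r0 normr0 => /eqP; rewrite eq_sym oner_eq0.
have An w : w != 0 -> A (`|w^T|^-1 *: w^T).
  move=> w0; rewrite /A /= normrZ normfV normr_id mulVf//.
  by rewrite normr_eq0 trmx_eq0.
have A0 : A !=set0.
  exists (`|(const_mx 1 : 'cV[R]_n)^T|^-1 *: (const_mx 1)^T); apply: An.
  by apply/eqP => /colP/(_ (Ordinal n0)); rewrite !mxE => /eqP; rewrite oner_eq0.
have cA : compact A.
  apply: bounded_closed_compact.
    by exists 1; split => // x x1 v; rewrite /A /= => ->; exact: ltW.
  have -> : A = (@Num.norm R 'rV[R]_n) @^-1` [set 1] by [].
  by apply: closed_comp => [x _|]; [exact: norm_continuous|exact: closed_eq].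
pose f (v : 'rV[R]_n) := bf S v^T v^T / bf P v^T v^T.
have cf : {within A, continuous f}.
  apply: continuous_in_subspaceT => v; rewrite inE => Av.
  apply: (continuous_div (@continuous_bf S) (@continuous_bf P)).
  by rewrite gt_eqF// P0// A_neq0.
have [v] := EVT_max_rV A0 cA cf; rewrite inE => Av vmax.
have v0 := A_neq0 _ Av; have Pv : 0 < bf P v^T v^T by exact: P0.
have le w : bf S w w <= f v * bf P w w.
  have [->|w0] := eqVneq w 0; first by rewrite !bf0l mulr0.
  have := vmax (`|w^T|^-1 *: w^T); rewrite inE => /(_ (An _ w0)).
  have Pw : 0 < bf P w w by exact: P0.
  have nw : `|w^T| != 0 by rewrite normr_eq0 trmx_eq0.
  rewrite {1}/f linearZ /= trmxK !(bfZl, bfZr).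
  have -> : `|w^T|^-1 * (`|w^T|^-1 * bf S w w) / (`|w^T|^-1 * (`|w^T|^-1 * bf P w w))
     = bf S w w / bf P w w by field; rewrite gt_eqF.
  by rewrite ler_pdivrMr.
exists (f v), v^T; split=> //.
have : psd (f v *: P - S).
  split=> [|w]; first by rewrite linearB linearZ /= sP sS.
  by rewrite bfDm bfNm bfZm subr_ge0.
move=> /(@psd_ker _ v^T); rewrite bfDm bfNm bfZm divfK ?gt_eqF// subrr.
by move=> /(_ erefl)/eqP; rewrite mulmxBr -scalemxAr subr_eq0 => /eqP.
Qed.

(** Eigenvectors are rows here, and [v^T S = m v^T P] says that [v^T] is one for [S P^-1]. Hence the
    supremum in [lambda_max] is attained and is the maximum of the quotient of [S] by [P], even when
    [S P^-1] is not symmetric. *)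
Lemma lambda_max_ub P S : (0 < n)%N -> posdef P -> S^T = S ->
  (forall w, bf S w w <= lambda_max (S *m invmx P) * bf P w w) /\
  eigenvalue (S *m invmx P) (lambda_max (S *m invmx P)).
Proof.
move=> n0 pP sS; have [m [v [v0 vS le]]] := rayleigh_max n0 pP sS.
have uP := posdef_unit pP.
have ev : eigenvalue (S *m invmx P) m.
  apply/eigenvalueP; exists v^T; last by rewrite trmx_eq0.
  by rewrite mulmxA vS -scalemxAl mulmxK.
suff -> : lambda_max (S *m invmx P) = m by [].
have ub : ubound [set a : R | eigenvalue (S *m invmx P) a] m.
  move=> a /= /eigenvalueP[u ua u0].
  have := le u^T; rewrite /bf trmxK -[u *m S](mulmxKV uP) -(mulmxA u) ua.
  rewrite -!scalemxAl mxE ler_pM2r//.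
  by have [_ /(_ u^T)] := pP; rewrite trmxK; apply; rewrite trmx_eq0.
apply/eqP; rewrite eq_le; apply/andP; split.
  by apply: ge_sup => //; exists m.
by apply: ub_le_sup => //; exists m.
Qed.

End BilinearForms.

(** * The Pascal solution of the equation for [Q] at [gamma = 1] *)

Section ParametricRiccati.
Variables (R : realType) (n : nat).
Implicit Types (M Q D : 'M[R]_n) (g : R).
Local Notation A := (Amat R n).
Local Notation b := (bvec R n).
Local Notation c := (cvec R n).

(** [A] shifts rows up by one. Extending the entries to a function on [nat] that vanishes in row [n]
    makes the last row obey the same formula. *)
Lemma Amat_mulE M (F : nat -> nat -> R) : (forall i j : 'I_n, M i j = F i j) ->
  (forall j, F n j = 0) -> forall i j : 'I_n, (A *m M) i j = F i.+1 j.
Proof.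
move=> MF F0 i j; rewrite mxE.
have [ltin|] := ltnP i.+1 n.
  rewrite (bigD1 (Ordinal ltin)) //= mxE eqxx mul1r MF big1 ?addr0// => k ki.
  rewrite mxE; have [E|_] := eqVneq (val k) i.+1; last by rewrite mul0r.
  by case/eqP: ki; exact: val_inj.
move=> nli; have -> : i.+1 = n by apply/eqP; rewrite eqn_leq ltn_ord nli.
rewrite F0 big1 // => k _; rewrite mxE ltn_eqF ?mul0r//.
exact: leq_trans (ltn_ord k) nli.
Qed.

Lemma cvec_mulE m (M : 'M[R]_(n, m)) (i0 : 'I_n) : val i0 = 0%N -> c *m M = row i0 M.
Proof.
move=> i00; apply/rowP => j; rewrite !mxE (bigD1 i0) //= mxE i00 eqxx mul1r.
rewrite big1 ?addr0// => k ki; rewrite mxE; case: eqP => [k0|_]; last by rewrite mul0r.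
by case/eqP: ki; apply: val_inj; rewrite i00.
Qed.

Definition pascal_mx : 'M[R]_n := \matrix_(m, i) ((-1) ^+ m * 'C(m, i)%:R).
Definition riccQ : 'M[R]_n := \matrix_(i, j) \sum_(m < n) ('C(m, i) * 'C(m, j))%:R.
Local Notation Q1 := riccQ.

Lemma Q1E (i j : 'I_n) : Q1 i j = \sum_(m < n) ('C(m, i) * 'C(m, j))%:R.
Proof. by rewrite mxE. Qed.

Lemma Q1_factor : Q1 = pascal_mx^T *m pascal_mx.
Proof.
apply/matrixP => i j; rewrite !mxE; apply: eq_bigr => m _.
by rewrite !mxE natrM mulrACA -expr2 sqrr_sign mul1r.
Qed.

Lemma coef_sign_mul (e j : nat) (p : {poly R}) : ((-1) ^+ e * p)`_j = (-1) ^+ e * p`_j.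
Proof.
rewrite -signr_odd -[in RHS]signr_odd.
by case: odd; rewrite ?expr0 ?expr1 ?mul1r ?mulN1r ?coefN.
Qed.

Lemma coef_exprX1 (m j : nat) : (('X + 1) ^+ m : {poly R})`_j = 'C(m, j)%:R.
Proof.
rewrite exprDn coef_sum; case: (ltnP m j) => mj.
  rewrite bin_small// big1 // => i _.
  by rewrite expr1n mulr1 coefMn coefXn gtn_eqF ?mul0rn// (leq_ltn_trans _ mj)// leq_subr.
rewrite (bigD1 (inord (m - j))) //= big1 ?addr0 => [|i ij].
  rewrite inordK ?ltnS ?leq_subr// expr1n mulr1 coefMn coefXn subKn// eqxx.
  by rewrite bin_sub.
rewrite expr1n mulr1 coefMn coefXn; case: eqP => [E|]; last by rewrite mul0rn.
case/eqP: ij; apply: val_inj; rewrite /= inordK ?ltnS ?leq_subr// E subKn//.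
by rewrite -ltnS.
Qed.

(* Coefficients of the expansion of [X^k = (-1 + (X + 1))^k] in powers of [X + 1]. *)
Lemma pascal_mx_sqr : pascal_mx *m pascal_mx = 1%:M.
Proof.
apply/matrixP => k j; rewrite !mxE.
have : ((- 1 + ('X + 1)) ^+ k : {poly R})`_j = (k == j)%:R.
  by rewrite addrC addrK coefXn eq_sym.
rewrite exprDn coef_sum => <-.
pose F m : R := ((-1) ^+ (k - m) * ('X + 1) ^+ m *+ 'C(k, m) : {poly R})`_j.
rewrite -[RHS](big_mkord xpredT F).
rewrite (eq_bigr (fun m : 'I_n => F m)) => [|m _]; last first.
  rewrite !mxE /F coefMn coef_sign_mul coef_exprX1.
  have [mk|km] := leqP m k; last by rewrite bin_small// mulr0 mul0r mulr0n.
  have -> : (-1) ^+ (k - m) = (-1) ^+ k * (-1) ^+ m :> R.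
    by rewrite -signr_odd oddB // signr_addb !signr_odd.
  by rewrite -mulr_natr; ring.
rewrite -(big_mkord xpredT F) (@big_cat_nat _ _ _ k.+1 0 n) //=.
rewrite [X in _ + X]big_nat [X in _ + X]big1 ?addr0// => m /andP[km _].
by rewrite /F bin_small// mulr0n coef0.
Qed.

Lemma pascal_mx_unit : pascal_mx \in unitmx.
Proof. by have [] := mulmx1_unit pascal_mx_sqr. Qed.

Lemma Q1_inv : invmx Q1 = pascal_mx *m pascal_mx^T.
Proof.
have Q1K : pascal_mx *m pascal_mx^T *m Q1 = 1%:M.
  rewrite Q1_factor mulmxA -(mulmxA pascal_mx) -trmx_mul pascal_mx_sqr trmx1 mulmx1.
  exact: pascal_mx_sqr.
have [_ uQ] := mulmx1_unit Q1K.
by rewrite -[LHS]mul1mx -Q1K mulmxK.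
Qed.

Lemma Q1_posdef : posdef Q1.
Proof.
rewrite Q1_factor; split=> [|v v0]; first by rewrite trmx_mul trmxK.
rewrite mulmxA -trmx_mul -mulmxA.
have := (posdef1 R n).2 (pascal_mx *m v); rewrite mulmx1; apply.
apply: contra v0 => /eqP /(congr1 (mulmx (invmx pascal_mx))).
by rewrite mulmx0 mulKmx ?pascal_mx_unit// => ->.
Qed.

(** By Pascal's rule the increment in [m] of [C(m,i+1) C(m,j+1)] is the sum of the three products
    whose sums over [m] are the entries of [A Q], [Q A^T] and [Q]. The total telescopes to
    [C(n,i+1) C(n,j+1)], the entry of [Q c^T c Q]. *)
Lemma Q1_are : A *m Q1 + Q1 *m A^T - Q1 *m c^T *m c *m Q1 = - Q1.
Proof.
have sQ : Q1^T = Q1 by case: Q1_posdef.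
pose F i j : R := \sum_(m < n) ('C(m, i) * 'C(m, j))%:R.
have F0 j : F n j = 0.
  by apply: big1 => m _; rewrite bin_small.
apply/matrixP => i j.
have i0 : (0 < n)%N by exact: leq_ltn_trans (ltn_ord i).
have E1 i' j' : (A *m Q1) i' j' = F i'.+1 j' by rewrite (Amat_mulE Q1E F0).
have E2 : (Q1 *m A^T) i j = F j.+1 i by rewrite -{1}sQ -trmx_mul mxE E1.
have E3 : (Q1 *m c^T *m c *m Q1) i j = F 0%N i * F 0%N j.
  rewrite -mulmxA (@cvec_mulE _ _ (Ordinal i0))// -{1}sQ -trmx_mul.
  by rewrite (@cvec_mulE _ _ (Ordinal i0))// mxE big_ord1 mxE [row _ _ _ _]mxE [X in _ * X]mxE !Q1E.
rewrite [LHS]mxE [X in X + _]mxE [X in _ + X]mxE [RHS]mxE E1 E2 E3 Q1E.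
(* Hockey-stick identity for the first row of [Q]. *)
have FS i' : F 0%N i' = 'C(n, i'.+1)%:R.
  rewrite /F -natr_sum; congr (_%:R).
  rewrite -(big_mkord xpredT (fun m => 'C(m, 0) * 'C(m, i'))%N).
  elim: n => [|k IH]; first by rewrite big_geq.
  by rewrite big_nat_recr //= IH bin0 mul1n binS.
have tel (k : nat) : \sum_(m < k) ('C(m, i.+1) * 'C(m, j))%:R + \sum_(m < k) ('C(m, j.+1) * 'C(m, i))%:R
   + \sum_(m < k) ('C(m, i) * 'C(m, j))%:R = 'C(k, i.+1)%:R * 'C(k, j.+1)%:R :> R.
  elim: k => [|k IH]; first by rewrite !big_ord0 !addr0 mul0r.
  rewrite !big_ord_recr /= !binS !natrD !mulrDl !mulrDr -IH !natrM; ring.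
rewrite FS FS -tel /F; ring.
Qed.

End ParametricRiccati.

(** * Uniqueness, scaling in [gamma], reversal, and the bound of [E] against [Q] *)

Section RiccatiSolutions.
Variables (R : realType) (n : nat).
Implicit Types (M Q D : 'M[R]_n) (g : R).
Local Notation A := (Amat R n).
Local Notation b := (bvec R n).
Local Notation c := (cvec R n).
Local Notation E := (Emat R n).
Local Notation Q1 := (riccQ R n).

(** [A] is nilpotent, hence so is the operator on the left, and a nonzero [g] is not an eigenvalue
    of it. Concretely, entry [(i, j)] of the left side only involves entries of [D] with a smaller
    index sum. *)
Lemma lyapunov_Amat_inj D g : g != 0 -> D *m A + A^T *m D = g *: D -> D = 0.
Proof.
move=> g0 eqD.
suff D0 m : forall i j : 'I_n, (i + j < m)%N -> D i j = 0.
  by apply/matrixP => i j; rewrite (D0 (i + j).+1)// mxE.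
elim: m => // m IH i j ijm.
have /eqP := congr1 (fun M : 'M[R]_n => M i j) eqD; rewrite !mxE !big1 ?addr0.
- by rewrite eq_sym mulf_eq0 (negPf g0) => /eqP.
- move=> k _; rewrite !mxE; have [ik|_] := eqVneq (val i) k.+1; last by rewrite mul0r.
  by rewrite IH ?mulr0// -ltnS (leq_trans _ ijm)// ltnS ltn_add2r ik.
- move=> k _; rewrite !mxE; have [jk|_] := eqVneq (val j) k.+1; last by rewrite mulr0.
  by rewrite IH ?mul0r// -ltnS (leq_trans _ ijm)// ltnS ltn_add2l jk.
Qed.

Definition q_are g Q := A *m Q + Q *m A^T - Q *m c^T *m c *m Q = - (g *: Q).

(** Multiplying by the inverse on both sides makes the quadratic term constant: the equation becomes
    affine in [Q^-1], and the difference of two inverses solves the homogeneous Lyapunov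
    equation. *)
Lemma q_are_unique g Q M : g != 0 -> posdef Q -> posdef M ->
  q_are g Q -> q_are g M -> Q = M.
Proof.
move=> g0 pQ pM eQ eM.
have inv_eq X : posdef X -> q_are g X ->
    invmx X *m A + A^T *m invmx X = c^T *m c - g *: invmx X.
  move=> /posdef_unit uX eX.
  suff <- : invmx X *m A + A^T *m invmx X - c^T *m c = - (g *: invmx X).
    by rewrite [RHS]addrC subrK.
  move: eX => /(congr1 (fun Y => invmx X *m Y *m invmx X)).
  rewrite mulmxN mulNmx -scalemxAr -scalemxAl mulVmx// mul1mx => <-.
  rewrite !(mulmxDr, mulmxDl, mulmxN, mulNmx) !mulmxA mulVmx// !mul1mx.
  by rewrite !mulmxK.
have /eqP : invmx Q - invmx M = 0.
  apply: (@lyapunov_Amat_inj _ (- g)); first by rewrite oppr_eq0.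
  rewrite mulmxBl mulmxBr addrACA -opprD (inv_eq Q)// (inv_eq M)//.
  by rewrite opprB addrC addrA subrK scaleNr scalerBr opprB.
by rewrite subr_eq0 => /eqP eqi; rewrite -[LHS]invmxK eqi invmxK.
Qed.

Definition powdiag g : 'M[R]_n := diag_mx (\row_i g ^+ i).

Lemma powdiag_tr g : (powdiag g)^T = powdiag g.
Proof. exact: tr_diag_mx. Qed.

Lemma powdiag_unit g : g != 0 -> powdiag g \in unitmx.
Proof.
move=> g0; rewrite unitmxE det_diag unitfE prodf_seq_neq0.
by apply/allP => i _; rewrite mxE expf_neq0.
Qed.

Lemma Amat_powdiag g : A *m powdiag g = g *: (powdiag g *m A).
Proof.
apply/matrixP => i j; rewrite mul_mx_diag [RHS]mxE mul_diag_mx !mxE.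
by have [->|_] := eqVneq (val j) i.+1; rewrite ?mul0r ?mulr0// mul1r mulr1 exprS.
Qed.

Lemma cvec_powdiag g : c *m powdiag g = c.
Proof.
apply/rowP => j; rewrite mul_mx_diag !mxE.
by have [->|_] := eqVneq (val j) 0%N; rewrite ?mul0r ?mulr1.
Qed.

Lemma powdiag_cvec g : powdiag g *m c^T = c^T.
Proof. by rewrite -{1}powdiag_tr -trmx_mul cvec_powdiag. Qed.

Lemma posdef_congr M K : posdef M -> K \in unitmx -> posdef (K^T *m M *m K).
Proof.
move=> [sM pM] uK; split=> [|v v0].
  by rewrite !trmx_mul trmxK sM mulmxA.
have := pM (K *m v); rewrite trmx_mul !mulmxA; apply.
by apply: contra v0 => /eqP/(congr1 (mulmx (invmx K))); rewrite mulKmx// mulmx0 => ->.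
Qed.

Lemma posdefZ M g : 0 < g -> posdef M -> posdef (g *: M).
Proof.
move=> g0 [sM pM]; split=> [|v v0]; first by rewrite linearZ /= sM.
by rewrite -[X in 0 < X]/(bf (g *: M) v v) bfZm mulr_gt0// pM.
Qed.

(** With [K] the diagonal of powers of [g], [A K = g K A] and [c K = c]. The linear terms then gain
    one [g] from the commutation and one from the outer factor, the quadratic term gains both from
    the outer factor, so [g^2] comes out of the whole equation. *)
Lemma q_are_scale Q g : q_are 1 Q -> q_are g (g *: (powdiag g *m Q *m powdiag g)).
Proof.
rewrite /q_are scale1r => eQ; set K := powdiag g.
have KA : K *m A^T = g *: (A^T *m K).
  by rewrite -{1}[K]powdiag_tr -trmx_mul Amat_powdiag linearZ /= trmx_mul powdiag_tr.
have t1 : A *m (K *m Q *m K) = g *: (K *m (A *m Q) *m K).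
  by rewrite !mulmxA Amat_powdiag -!scalemxAl.
have t2 : K *m Q *m K *m A^T = g *: (K *m (Q *m A^T) *m K).
  by rewrite -mulmxA KA -scalemxAr !mulmxA.
have t3 : K *m Q *m K *m c^T *m c *m (K *m Q *m K) = K *m (Q *m c^T *m c *m Q) *m K.
  by rewrite -(mulmxA _ K c^T) powdiag_cvec !mulmxA -(mulmxA _ c K) cvec_powdiag.
rewrite -!scalemxAr -!scalemxAl t1 t2 t3 -!scalerDr -!scalerBr.
by rewrite -mulmxDl -mulmxDr -mulmxBl -mulmxBr eQ mulmxN mulNmx !scalerN.
Qed.

Lemma QmatE g : 0 < g -> Qmat n g = g *: (powdiag g *m Q1 *m powdiag g).
Proof.
move=> g0; set K := powdiag g.
have pQ : posdef (g *: (K *m Q1 *m K)).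
  apply: posdefZ => //; rewrite -{1}[K]powdiag_tr; apply: posdef_congr => //.
    exact: Q1_posdef.
  by rewrite powdiag_unit ?gt_eqF.
have eQ : q_are g (g *: (K *m Q1 *m K)).
  by apply: q_are_scale; rewrite /q_are scale1r Q1_are.
apply: xget_unique => [|M [pM eM]]; first by split.
by apply: (@q_are_unique g) => //; rewrite gt_eqF.
Qed.

Definition rev_mx : 'M[R]_n := \matrix_(i, j) (i == rev_ord j)%:R.
Local Notation J := rev_mx.

Lemma rev_mx_mulE m (M : 'M[R]_(n, m)) i j : (J *m M) i j = M (rev_ord i) j.
Proof.
rewrite mxE (bigD1 (rev_ord i)) //= mxE rev_ordK eqxx mul1r big1 ?addr0// => k ki.
by rewrite mxE -(inj_eq rev_ord_inj) rev_ordK eq_sym (negPf ki) mul0r.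
Qed.

Lemma rev_mx_tr : J^T = J.
Proof.
apply/matrixP => i j; rewrite !mxE; congr (nat_of_bool _)%:R.
by apply/eqP/eqP => ->; rewrite rev_ordK.
Qed.

Lemma rev_mx_sqr : J *m J = 1%:M.
Proof. apply/matrixP => i j; rewrite rev_mx_mulE !mxE; congr (nat_of_bool _)%:R.
exact: (inj_eq rev_ord_inj). Qed.

Lemma rev_mxK m (M : 'M[R]_(n, m)) : J *m (J *m M) = M.
Proof. by rewrite mulmxA rev_mx_sqr mul1mx. Qed.

Lemma mul_rev_mxK m (M : 'M[R]_(m, n)) : M *m J *m J = M.
Proof. by rewrite -mulmxA rev_mx_sqr mulmx1. Qed.

Lemma rev_mx_unit : J \in unitmx.
Proof. by have [] := mulmx1_unit rev_mx_sqr. Qed.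

Lemma mul_rev_mxE m (M : 'M[R]_(m, n)) i j : (M *m J) i j = M i (rev_ord j).
Proof. by rewrite -{1}rev_mx_tr -[M]trmxK -trmx_mul mxE rev_mx_mulE !mxE. Qed.

Lemma rev_Amat : J *m A *m J = A^T.
Proof.
apply/matrixP => i j; rewrite mul_rev_mxE rev_mx_mulE !mxE /=; congr (nat_of_bool _)%:R.
have i_lt := ltn_ord i; have j_lt := ltn_ord j.
apply/idP/idP => /eqP E; apply/eqP; lia.
Qed.

Lemma rev_bvec : J *m b = c^T.
Proof.
apply/matrixP => i j; rewrite rev_mx_mulE !mxE /=; congr (nat_of_bool _)%:R.
have i_lt := ltn_ord i.
apply/idP/idP => /eqP E; apply/eqP; lia.
Qed.

Lemma rev_conjK M : J *m (J *m M *m J) *m J = M.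
Proof. by rewrite !mulmxA rev_mx_sqr mul1mx mul_rev_mxK. Qed.

Definition p_are g M := A^T *m M + M *m A - M *m b *m b^T *m M = - (g *: M).

(** Reversing the order of coordinates exchanges [A] with [A^T] and [b] with [c^T], hence the two
    Riccati equations. *)
Lemma rev_are g M : p_are g M <-> q_are g (J *m M *m J).
Proof.
have JA : J *m A^T *m J = A by rewrite -rev_Amat !mulmxA rev_mx_sqr mul1mx mul_rev_mxK.
have bJ : b^T *m J = c by rewrite -{1}rev_mx_tr -trmx_mul rev_bvec trmxK.
have t1 : A *m (J *m M *m J) = J *m (A^T *m M) *m J by rewrite -{1}JA !mulmxA mul_rev_mxK.
have t2 : J *m M *m J *m A^T = J *m (M *m A) *m J.
  by rewrite -rev_Amat !mulmxA mul_rev_mxK.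
have t3 : J *m M *m J *m c^T *m c *m (J *m M *m J) = J *m (M *m b *m b^T *m M) *m J.
  by rewrite -rev_bvec -bJ !mulmxA !mul_rev_mxK.
rewrite /p_are /q_are t1 t2 t3 -mulmxDl -mulmxDr -mulmxBl -mulmxBr.
split=> [->|e]; first by rewrite mulmxN mulNmx -scalemxAr -scalemxAl.
rewrite -[LHS]rev_conjK e mulmxN mulNmx -scalemxAr -scalemxAl.
by rewrite rev_conjK.
Qed.

Lemma Qmat_posdef g : 0 < g -> posdef (Qmat n g).
Proof.
move=> g0; rewrite QmatE//; apply: posdefZ => //.
rewrite -{1}powdiag_tr; apply: posdef_congr; first exact: Q1_posdef.
by rewrite powdiag_unit ?gt_eqF.
Qed.

Lemma Qmat_are g : 0 < g -> q_are g (Qmat n g).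
Proof. by move=> g0; rewrite QmatE//; apply: q_are_scale; rewrite /q_are scale1r Q1_are. Qed.

Lemma rev_posdef M : posdef M -> posdef (J *m M *m J).
Proof. by move=> pM; rewrite -{1}rev_mx_tr; apply: posdef_congr => //; exact: rev_mx_unit. Qed.

Lemma PmatE g : 0 < g -> Pmat n g = J *m Qmat n g *m J.
Proof.
move=> g0; apply: xget_unique => [|M [pM eM]].
  split; first exact/rev_posdef/Qmat_posdef.
  by apply/rev_are; rewrite rev_conjK; exact: Qmat_are.
rewrite -[M]rev_conjK (@q_are_unique g (J *m M *m J) (Qmat n g)) ?gt_eqF//.
- exact: rev_posdef.
- exact: Qmat_posdef.
- exact/rev_are.
- exact: Qmat_are.
Qed.

Lemma QnE : Qn R n = Q1.
Proof.
rewrite /Qn QmatE// scale1r.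
have -> : powdiag 1 = 1%:M.
  by apply/matrixP => i j; rewrite !mxE expr1n; case: eqP.
by rewrite mul1mx mulmx1.
Qed.

Lemma PnE : Pn R n = J *m Q1 *m J.
Proof. by rewrite /Pn PmatE// -/(Qn R n) QnE. Qed.

Definition riccP := J *m Q1 *m J.
Local Notation P1 := riccP.

Lemma P1_posdef : posdef P1.
Proof. exact/rev_posdef/Q1_posdef. Qed.

Lemma P1_are : p_are 1 P1.
Proof. by apply/rev_are; rewrite rev_conjK /q_are scale1r Q1_are. Qed.

Lemma EmatE : E = n.-1%:R%:M - diag_mx (\row_i (val i)%:R).
Proof.
apply/matrixP => i j; rewrite !mxE.
have [->|_] := eqVneq i j; last by rewrite mul0r subr0.
by rewrite mul1r natrB// -ltnS prednK// (leq_ltn_trans _ (ltn_ord j)).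
Qed.

Lemma bf_rank1 Q (u w v : 'cV[R]_n) : Q^T = Q ->
  bf (Q *m u *m u^T *m Q) v w = bf Q u v * bf Q u w.
Proof.
move=> sQ; rewrite (bfC u v sQ) /bf !mulmxA -(mulmxA _ u^T) -(mulmxA _ (u^T *m Q)).
by rewrite mxE big_ord1.
Qed.

Lemma q_are_bf g Q u v : Q^T = Q -> q_are g Q ->
  bf Q (A^T *m u) v + bf Q u (A^T *m v) - bf Q c^T u * bf Q c^T v = - (g * bf Q u v).
Proof.
move=> sQ /(congr1 (fun M => bf M u v)); rewrite bfNm bfZm => <-.
by rewrite !bfDm bfNm -(bf_rank1 c^T v u sQ) trmxK (bfMl A) (bfMr Q).
Qed.

(* Differentiating the Riccati equation with respect to [g] turns [Q(g)] into
   [Q1 + F Q1 + Q1 F] at [g = 1], with [F = diag(0, ..., n - 1)]; the bound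
   amounts to comparing this derivative with [Q1 / n]. *)
Lemma Emat_Q1_le w : (0 < n)%N ->
  bf (E *m Q1 + Q1 *m E) w w <= (2 * n%:R - 1 - n%:R^-1) * bf Q1 w w.
Proof.
move=> n0; pose F : 'M[R]_n := diag_mx (\row_i (val i)%:R).
have nR : 0 < n%:R :> R by rewrite ltr0n.
have pQ := Q1_posdef R n; have [sQ Q0] := pQ.
have FA : F *m A^T = A^T *m F + A^T.
  apply/matrixP => i j; rewrite /F mul_diag_mx [RHS]mxE mul_mx_diag !mxE.
  have [->|_] := eqVneq (val i) j.+1; last by rewrite mulr0 mul0r addr0.
  by rewrite mul1r mulr1 -natr1.
have Fc : F *m c^T = 0.
  apply/matrixP => i j; rewrite /F mul_diag_mx !mxE.
  by have [->|_] := eqVneq (val i) 0%N; rewrite ?mul0r ?mulr0.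
have sF : F^T = F by exact: tr_diag_mx.
pose V := F *m Q1 + Q1 *m F.
have bfV u v : bf V u v = bf Q1 (F *m u) v + bf Q1 u (F *m v).
  by rewrite bfDm bfMl bfMr sF.
pose Z := (1 - n%:R^-1) *: Q1 + V.
have sZ : (- Z)^T = - Z.
  by rewrite linearN /= /Z /V !linearD linearZ /= (trmx_mul F) (trmx_mul _ F) sF sQ (addrC (- (Q1 *m F))).
(* Because [E = (n-1) I - F], the claim amounts to [Z >= 0], that is to [m <= 0] for the largest
   generalized eigenvalue [m] of [-Z] relative to [Q1]. *)
have [m [v [v0 vZ le]]] := rayleigh_max n0 pQ sZ.
have bfZ u : bf V v u = - (m + 1 - n%:R^-1) * bf Q1 v u.
  have : bf (- Z) v u = m * bf Q1 v u by rewrite /bf vZ -scalemxAl mxE.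
  by rewrite bfNm bfDm bfZm; lra.
have q0 : 0 < bf Q1 v v by exact: Q0.
have Q1_are1 : q_are 1 Q1 by rewrite /q_are scale1r Q1_are.
(* The Riccati equation is tested on [(F v, v)] and [(v, v)], the eigenvector relation on [A^T v],
   [c^T] and [v]. Eliminating the mixed terms leaves [m y^2 = y^2 / n - q], with [y = c Q v] and
   [q = v^T Q v]. *)
have e1 := q_are_bf (F *m v) v sQ Q1_are1.
have e2 := q_are_bf v v sQ Q1_are1.
have z1 := bfZ (A^T *m v).
have z2 := bfZ c^T.
have z3 := bfZ v.
rewrite !bfV Fc in z1 z2 z3.
have bfQ0 u : bf Q1 u 0 = 0 by rewrite -(scale0r 0) bfZr mul0r.
rewrite bfQ0 addr0 in z2; rewrite (mulmxA F) FA mulmxDl bfDr -mulmxA in z1.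
rewrite (bfC v (F *m v) sQ) in z3.
rewrite (bfC (F *m v) c^T sQ) (bfC v c^T sQ) in z2.
rewrite (bfC (A^T *m (F *m v)) v sQ) in e1.
rewrite (bfC (A^T *m v) v sQ) in e2.
set a := bf Q1 v (A^T *m v) in z1 e2 *.
set y := bf Q1 c^T v in z2 e1 e2 *.
set q := bf Q1 v v in z3 e2 q0 *.
have my : m * y ^+ 2 = y ^+ 2 / n%:R - q by rewrite !expr2 in e1 *; nra.
(* Source of the [1/n] in the constant: [c Q c^T] is the corner entry of [Q], a sum of [n] ones. *)
have yq : y ^+ 2 <= n%:R * q.
  have := psd_CS c^T v (posdef_psd pQ).
  suff -> : bf Q1 c^T c^T = n%:R by [].
  rewrite /bf trmxK -mulmxA (@cvec_mulE _ _ _ _ (Ordinal n0))// mxE.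
  rewrite -sQ -trmx_mul mxE (@cvec_mulE _ _ _ _ (Ordinal n0))// mxE Q1E /=.
  by rewrite (eq_bigr (fun=> 1)) ?sumr_const ?card_ord// => i _; rewrite !bin0.
have m0 : m <= 0.
  rewrite leNgt; apply/negP => m0.
  have ny : y ^+ 2 / n%:R <= q by rewrite ler_pdivrMr// mulrC.
  have y0 : y ^+ 2 = 0.
    apply/eqP; rewrite eq_le sqr_ge0 andbT -(pmulr_rle0 _ m0) my; lra.
  by move: my; rewrite y0 mul0r mulr0 => q00; move: q0; lra.
have := le w; rewrite bfNm bfDm bfZm.
have -> : bf V w w = 2 * n.-1%:R * bf Q1 w w - bf (E *m Q1 + Q1 *m E) w w.
  rewrite EmatE mulmxBl mulmxBr mul_scalar_mx mul_mx_scalar !(bfDm, bfNm, bfZm); ring.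
have -> : n.-1%:R = n%:R - 1 :> R by rewrite -{2}(prednK n0) -natr1 addrK.
have : m * bf Q1 w w <= 0 by rewrite mulr_le0_ge0// (posdef_psd pQ).2.
lra.
Qed.


End RiccatiSolutions.

(** * Bounds by [Lambda] and [delta_c] *)

Section SpectralBounds.
Variables (R : realType) (n : nat).
Hypothesis n0 : (0 < n)%N.
Implicit Types (M Q D S X Y : 'M[R]_n) (g a : R) (u v w e : 'cV[R]_n).
Local Notation A := (Amat R n).
Local Notation b := (bvec R n).
Local Notation c := (cvec R n).
Local Notation E := (Emat R n).
Local Notation Q1 := (riccQ R n).
Local Notation P1 := (riccP R n).
Local Notation J := (rev_mx R n).
Local Notation L := (Lambda R n).
Local Notation I := (1%:M : 'M[R]_n).

Lemma eigenvalue_mulC X Y a : X \in unitmx ->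
  eigenvalue (X *m Y) a -> eigenvalue (Y *m X) a.
Proof.
move=> uX /eigenvalueP[v va v0]; apply/eigenvalueP; exists (v *m X).
  by rewrite !mulmxA -(mulmxA v) va scalemxAl.
by apply: contra v0 => /eqP/(congr1 (mulmx^~ (invmx X))); rewrite mulmxK// mul0mx => ->.
Qed.

Lemma eigenvalue_le_lambda_max S a : S^T = S -> eigenvalue S a -> a <= lambda_max S.
Proof.
move=> sS /eigenvalueP[v va v0].
have [/(_ v^T)] := lambda_max_ub n0 (posdef1 R n) sS.
have -> : invmx I = I by rewrite -[LHS]mulmx1 mulVmx// unitmx1.
rewrite mulmx1 {1}/bf trmxK va -scalemxAl mxE.
have -> : (v *m v^T) ord0 ord0 = bf I v^T v^T by rewrite /bf trmxK mulmx1.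
by rewrite ler_pM2r//; apply: (posdef1 R n).2; rewrite trmx_eq0.
Qed.

Lemma bf_le_eigenvalue S a w : S^T = S -> (forall x, eigenvalue S x -> x <= a) ->
  bf S w w <= a * bf I w w.
Proof.
move=> sS le.
have [/(_ w) h ev] := lambda_max_ub n0 (posdef1 R n) sS.
have iI : invmx I = I by rewrite -[LHS]mulmx1 mulVmx// unitmx1.
rewrite iI mulmx1 in h ev.
apply: (le_trans h); apply: ler_wpM2r; last exact: le.
exact: (posdef_psd (posdef1 R n)).2.
Qed.

(** Cauchy-Schwarz for [M^-1] applied to [w] and [M w] gives [|w|^4 <= (w^T M^-1 w) (w^T M w)]. *)
Lemma bf_inv_ge M a w : posdef M -> bf (invmx M) w w <= a * bf I w w ->
  bf I w w <= a * bf M w w.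
Proof.
move=> pM le; have [->|w0] := eqVneq w 0.
  by rewrite !bf0l mulr0.
have I0 : 0 < bf I w w by exact: (posdef1 R n).2.
have uM := posdef_unit pM.
have := psd_CS w (M *m w) (posdef_psd (posdef_inv pM)).
have -> : bf (invmx M) w (M *m w) = bf I w w by rewrite -bfMr mulVmx.
have -> : bf (invmx M) (M *m w) (M *m w) = bf M w w.
  by rewrite -bfMr mulVmx// /bf trmx_mul pM.1 mulmx1.
move=> h; rewrite -(ler_pM2l I0) -expr2; apply: (le_trans h).
rewrite mulrCA mulrA; apply: ler_wpM2r => //.
exact: (posdef_psd pM).2.
Qed.

Lemma P1_eigenvalue a : eigenvalue Q1 a -> eigenvalue P1 a.
Proof.
rewrite -[X in eigenvalue X](rev_mxK Q1).
by move=> /(eigenvalue_mulC (rev_mx_unit R n)).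
Qed.

(** [Q^-1 = M M^T] is similar to [M^T M = Q], so inversion preserves the spectrum; this is why the
    single constant [Lambda] serves for upper and lower bounds alike. *)
Lemma Q1_inv_eigenvalue a : eigenvalue (invmx Q1) a -> eigenvalue P1 a.
Proof.
rewrite Q1_inv => /(eigenvalue_mulC (pascal_mx_unit R n)).
by rewrite -Q1_factor; exact: P1_eigenvalue.
Qed.

Lemma P1_inv : invmx P1 = J *m invmx Q1 *m J.
Proof.
have uQ := posdef_unit (Q1_posdef R n).
have h : J *m invmx Q1 *m J *m P1 = 1%:M.
  by rewrite /riccP !mulmxA mul_rev_mxK mulmxKV// rev_mx_sqr.
by rewrite -[LHS]mul1mx -h mulmxK// posdef_unit//; exact: P1_posdef.
Qed.

Lemma LambdaE : L = lambda_max P1.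
Proof. by rewrite /Lambda PnE. Qed.

Lemma P1_le w : bf P1 w w <= L * bf I w w.
Proof.
have sP := (P1_posdef R n).1.
by apply: bf_le_eigenvalue => // x /(eigenvalue_le_lambda_max sP); rewrite LambdaE.
Qed.

Lemma Q1_inv_le w : bf (invmx Q1) w w <= L * bf I w w.
Proof.
have sP := (P1_posdef R n).1; have sQ := (posdef_inv (Q1_posdef R n)).1.
apply: bf_le_eigenvalue => // x /Q1_inv_eigenvalue/(eigenvalue_le_lambda_max sP).
by rewrite LambdaE.
Qed.

Lemma P1_ge w : bf I w w <= L * bf P1 w w.
Proof.
have sP := (P1_posdef R n).1; have sPi := (posdef_inv (P1_posdef R n)).1.
apply: bf_inv_ge (P1_posdef R n) _; apply: bf_le_eigenvalue => // x.
rewrite P1_inv -mulmxA => /(eigenvalue_mulC (rev_mx_unit R n)); rewrite mul_rev_mxK.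
by move=> /Q1_inv_eigenvalue/(eigenvalue_le_lambda_max sP); rewrite LambdaE.
Qed.

Lemma Q1_inv_ge w : bf I w w <= L * bf (invmx Q1) w w.
Proof.
have sP := (P1_posdef R n).1; have sQ := (Q1_posdef R n).1.
apply: bf_inv_ge (posdef_inv (Q1_posdef R n)) _; rewrite invmxK.
apply: bf_le_eigenvalue => // x /P1_eigenvalue/(eigenvalue_le_lambda_max sP).
by rewrite LambdaE.
Qed.

Lemma Lambda_gt0 : 0 < L.
Proof.
have w0 : (const_mx 1 : 'cV[R]_n) != 0.
  by apply/eqP => /colP/(_ (Ordinal n0)); rewrite !mxE => /eqP; rewrite oner_eq0.
have := P1_ge (const_mx 1); rewrite ltNge => h; apply/negP => L0.
have : 0 < bf I (const_mx 1) (const_mx 1) by exact: (posdef1 R n).2.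
rewrite ltNge => /negP; apply; apply: (le_trans h).
by rewrite mulr_le0_ge0// (posdef_psd (P1_posdef R n)).2.
Qed.

Lemma Emat_tr : E^T = E.
Proof.
by apply/matrixP => i j; rewrite !mxE eq_sym; have [->|_] := eqVneq i j; rewrite ?mul0r.
Qed.

Lemma bf_Emat M w : M^T = M -> bf (E *m M + M *m E) w w = 2 * bf M w (E *m w).
Proof.
by move=> sM; rewrite bfDm bfMl bfMr Emat_tr (bfC _ _ sM); ring.
Qed.

(** [E + P E P^-1 = (E P + P E) P^-1], so the eigenvalue in [delta_c] is the maximum of the quotient
    of the symmetric matrix [E P + P E] by [P]. *)
Lemma Emat_P1_le w :
  2 * bf P1 w (E *m w) <= (delta_c R n / n%:R - 1) * bf P1 w w.
Proof.
have pP := P1_posdef R n; have [sP _] := pP; have uP := posdef_unit pP.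
rewrite -bf_Emat//.
have sS : (E *m P1 + P1 *m E)^T = E *m P1 + P1 *m E.
  by rewrite linearD /= (trmx_mul E) (trmx_mul _ E) Emat_tr sP addrC.
have [/(_ w) h _] := lambda_max_ub n0 pP sS; apply: (le_trans h).
rewrite mulmxDl mulmxK// /delta_c PnE -/(riccP R n) mulrAC divff; last by rewrite pnatr_eq0 -lt0n.
by rewrite mul1r (addrAC 1) subrr add0r.
Qed.

(** The bound on [E Q + Q E] evaluated at [Q^-1 e]. *)
Lemma Emat_Q1_inv_le e :
  2 * bf (invmx Q1) e (E *m e) <= (2 * n%:R - 1 - n%:R^-1) * bf (invmx Q1) e e.
Proof.
have pQ := Q1_posdef R n; have [sQ _] := pQ; have uQ := posdef_unit pQ.
have [sQi _] := posdef_inv pQ.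
have := Emat_Q1_le (invmx Q1 *m e) n0.
rewrite bf_Emat// => h.
have H v : bf Q1 (invmx Q1 *m e) v = bf I e v.
  by rewrite /bf trmx_mul sQi mulmxKV// mulmx1.
have H2 x : bf I e (x *m e) = bf x e e by rewrite -bfMr mul1mx.
rewrite !H mulmxA !H2 bfMl Emat_tr (bfC _ _ sQi) in h.
exact: h.
Qed.

End SpectralBounds.

(** * Decrease of the Lyapunov function *)

Section LyapunovDecrease.
Variables (R : realType) (n : nat).
Hypothesis n0 : (0 < n)%N.
Implicit Types (M Q D S X Y : 'M[R]_n) (g a bt d : R) (u v w e psi : 'cV[R]_n).
Local Notation A := (Amat R n).
Local Notation b := (bvec R n).
Local Notation c := (cvec R n).
Local Notation E := (Emat R n).
Local Notation Q1 := (riccQ R n).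
Local Notation Qi := (invmx Q1).
Local Notation P1 := (riccP R n).
Local Notation L := (Lambda R n).
Local Notation I := (1%:M : 'M[R]_n).
Local Notation qc := (Q1 *m c^T).

Definition kappa := 2 * bf P1 qc qc.

Definition lyap w e := bf P1 w w + kappa * bf Qi e e.

Lemma Qi_posdef : posdef Qi.
Proof. exact/posdef_inv/Q1_posdef. Qed.

Lemma Q1_inv_qc e : bf Qi e qc = (c *m e) ord0 ord0.
Proof.
rewrite -bfMr mulVmx ?posdef_unit//; last exact: Q1_posdef.
by rewrite (bfC _ _ (trmx1 _ _)) /bf trmxK mulmx1.
Qed.

Lemma kappa_gt0 : 0 < kappa.
Proof.
rewrite mulr_gt0//; apply: (P1_posdef R n).2; apply/eqP => /(congr1 (mulmx Qi)).
rewrite mulKmx ?posdef_unit//; last exact: Q1_posdef.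
rewrite mulmx0 => /matrixP/(_ (Ordinal n0) ord0); rewrite !mxE eqxx => /eqP.
by rewrite oner_eq0.
Qed.

Lemma kappaE : (c *m Qn R n *m Pn R n *m Qn R n *m c^T) ord0 ord0 = kappa / 2.
Proof.
rewrite QnE PnE /kappa mulrAC divff ?mul1r// /bf trmx_mul trmxK (Q1_posdef R n).1.
by rewrite -/(riccP R n) !mulmxA.
Qed.

(** The Riccati equation read on the diagonal. The square has the wrong sign for stability and is
    overturned by the feedback [- (b^T P w) b], which contributes it twice with a minus sign. *)
Lemma P1_Amat w : 2 * bf P1 w (A *m w) = bf P1 b w ^+ 2 - bf P1 w w.
Proof.
have [sP _] := P1_posdef R n.
have := congr1 (fun M => bf M w w) (P1_are R n).
rewrite bfNm bfZm !bfDm bfNm (bf_rank1 b w w sP) (bfMl A^T) trmxK (bfMr P1).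
rewrite (bfC (A *m w) w sP); lra.
Qed.

Lemma Q1_inv_Amat e :
  2 * bf Qi e (A *m e) = (c *m e) ord0 ord0 ^+ 2 - bf Qi e e.
Proof.
have [sQ _] := Q1_posdef R n; have [sQi _] := Qi_posdef.
have uQ := posdef_unit (Q1_posdef R n).
have Q1_are1 : q_are 1 Q1 by rewrite /q_are scale1r Q1_are.
have := q_are_bf (Qi *m e) (Qi *m e) sQ Q1_are1.
have H u : bf Q1 u (Qi *m e) = bf I u e by rewrite -bfMr mulmxV.
rewrite (bfC _ (A^T *m _) sQ) !H.
have -> : bf I c^T e = (c *m e) ord0 ord0 by rewrite /bf trmxK mulmx1.
have -> : bf I (A^T *m (Qi *m e)) e = bf Qi e (A *m e).
  by rewrite /bf !trmx_mul !trmxK sQi mulmx1 !mulmxA.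
have -> : bf I (Qi *m e) e = bf Qi e e by rewrite /bf trmx_mul sQi mulmx1.
lra.
Qed.

Lemma bf1_sum_le w e : bf I (w + e) (w + e) <= 2 * L * (bf P1 w w + bf Qi e e).
Proof.
have := psd_sqD w e (posdef_psd (posdef1 R n)).
have := P1_ge n0 w; have := Q1_inv_ge n0 e; lra.
Qed.

(** Cauchy-Schwarz followed by [q (p + q) <= ((p + 2 q) / 2)^2], which keeps the bound linear in the
    two parts of the Lyapunov function. *)
Lemma abs_Q1_inv_le K w e u : 0 <= K ->
  bf Qi u u <= K ^+ 2 * (bf P1 w w + bf Qi e e) ->
  `|bf Qi e u| <= K / 2 * (bf P1 w w + 2 * bf Qi e e).
Proof.
move=> K0 h; have pQi := posdef_psd Qi_posdef.
have p0 : 0 <= bf P1 w w := (posdef_psd (P1_posdef R n)).2 w.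
have q0 := pQi.2 e; have CS := psd_CS e u pQi.
rewrite -ler_sqr ?nnegrE//; last first.
  by rewrite mulr_ge0 ?divr_ge0// addr_ge0// mulr_ge0.
rewrite real_normK ?num_real//; apply: (le_trans CS).
apply: (@le_trans _ _ (bf Qi e e * (K ^+ 2 * (bf P1 w w + bf Qi e e)))).
  exact: ler_wpM2l.
rewrite -subr_ge0.
have -> : (K / 2 * (bf P1 w w + 2 * bf Qi e e)) ^+ 2
    - bf Qi e e * (K ^+ 2 * (bf P1 w w + bf Qi e e)) = (K / 2 * bf P1 w w) ^+ 2.
  by field.
exact: sqr_ge0.
Qed.

Lemma lyap_decrease bt d w e psi : 0 <= d ->
  8 * Num.sqrt 2 * n%:R * d * L * (kappa / 2) + 2 * (2 + delta_c R n / n%:R) <= bt ->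
  4 * Num.sqrt 2 * d * L + 2 * (2 * n%:R + 2 - n%:R^-1) <= bt ->
  bf I psi psi <= d ^+ 2 * bf I (w + e) (w + e) ->
  2 * bf P1 w (bt *: (A *m w) - (bt * bf P1 b w) *: b + E *m w
               + (bt * (c *m e) ord0 ord0) *: qc)
  + kappa * (2 * bf Qi e (bt *: (A *m e) - (bt * (c *m e) ord0 ord0) *: qc
               + E *m e + psi)) <= - 3 * lyap w e.
Proof.
move=> d0 hb1 hb2 hpsi; have k0 := kappa_gt0.
have [sP _] := P1_posdef R n.
have n1 : 1 <= n%:R :> R by rewrite ler1n.
have in1 : n%:R^-1 <= 1 :> R by rewrite invf_le1// ltr0n.
have L0 := Lambda_gt0 R n0.
rewrite !(bfDr, bfNr, bfZr) Q1_inv_qc (bfC w b sP).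
have hA := P1_Amat w; have hE := Emat_P1_le n0 w.
have hAe := Q1_inv_Amat e; have hEe := Emat_Q1_inv_le n0 e.
(* [D^2 = Lambda * d^2 * 2 Lambda]: one [Lambda] bounds [Q^-1] on [psi], and [2 Lambda] bounds
   [|w + e|^2] by the two quadratic forms. *)
pose D := Num.sqrt 2 * d * L.
have D0 : 0 <= D by rewrite !mulr_ge0 ?sqrtr_ge0// ltW.
have hP : `|bf Qi e psi| <= D / 2 * (bf P1 w w + 2 * bf Qi e e).
  apply: abs_Q1_inv_le => //; apply: (le_trans (Q1_inv_le n0 psi)).
  have -> : D ^+ 2 * (bf P1 w w + bf Qi e e) =
      L * (d ^+ 2 * (2 * L * (bf P1 w w + bf Qi e e))).
    by rewrite /D !exprMn sqr_sqrtr//; ring.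
  rewrite ler_pM2l//; apply: (le_trans hpsi).
  by apply: ler_wpM2l; [exact: sqr_ge0|exact: bf1_sum_le].
have {hP}hP := le_trans (ler_norm _) hP.
(* [kappa] is the weight for which the [(c e)^2] produced here cancels against the
   output injection in the equation of [e]. *)
have cross : 2 * ((c *m e) ord0 ord0 * bf P1 w qc) <=
    bf P1 w w / 2 + kappa * (c *m e) ord0 ord0 ^+ 2.
  have half0 : 0 < 2^-1 :> R by rewrite invr_gt0.
  have := psd_young w ((c *m e) ord0 ord0 *: qc) (posdef_psd (P1_posdef R n)) half0.
  by rewrite invrK !(bfZr, bfZl) /kappa; lra.
have p0 : 0 <= bf P1 w w := (posdef_psd (P1_posdef R n)).2 w.
have q0 : 0 <= bf Qi e e := (posdef_psd Qi_posdef).2 e.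
rewrite /lyap.
set t := (c *m e) ord0 ord0 in hAe cross *.
set s := bf P1 b w in hA *.
set p := bf P1 w w in p0 hA hE hP cross *.
set q := bf Qi e e in q0 hAe hEe hP *.
set pA := bf P1 w (A *m w) in hA *.
set qA := bf Qi e (A *m e) in hAe *.
set r := bf P1 w qc in cross *.
set x := bf Qi e psi in hP *.
set pE := bf P1 w (E *m w) in hE *.
set qE := bf Qi e (E *m e) in hEe *.
have bt0 : 0 <= bt by rewrite /D in D0; lra.
have kD : 0 <= kappa * D by rewrite mulr_ge0// ltW.
(* The net coefficients of [p] and [kappa q]. The cross term consumes half of [- bt p], so [bt / 2]
   remains here while [c2] keeps all of [bt]; the two lower bounds on [bt] are what these
   inequalities require, with room to spare. *)
have c1 : - (bt / 2) + (delta_c R n / n%:R - 1) + kappa * D <= - 3.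
  have h : kappa * D <= n%:R * (kappa * D) by rewrite ler_peMl.
  have e1 : 8 * Num.sqrt 2 * n%:R * d * L * (kappa / 2) = 4 * (n%:R * (kappa * D)).
    by rewrite /D; field.
  rewrite e1 in hb1; lra.
have c2 : - bt + (2 * n%:R - 1 - n%:R^-1) + 2 * D <= - 3.
  by rewrite /D in D0 *; lra.
have f1 : bt * (2 * (t * r)) <= bt * (p / 2 + kappa * t ^+ 2) by exact: ler_wpM2l.
have f2 : kappa * (2 * qE) <= kappa * ((2 * n%:R - 1 - n%:R^-1) * q).
  by rewrite ler_pM2l.
have f3 : kappa * (2 * x) <= kappa * (D * (p + 2 * q)) by rewrite ler_pM2l//; lra.
have f4 : p * (- (bt / 2) + (delta_c R n / n%:R - 1) + kappa * D) <= p * - 3.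
  exact: ler_wpM2l.
have f5 : kappa * q * (- bt + (2 * n%:R - 1 - n%:R^-1) + 2 * D) <= kappa * q * - 3.
  by apply: ler_wpM2l => //; rewrite mulr_ge0// ltW.
have f6 : 0 <= bt * s ^+ 2 by rewrite mulr_ge0// sqr_ge0.
have -> : pA = (s ^+ 2 - p) / 2 by lra.
have -> : qA = (t ^+ 2 - q) / 2 by lra.
(* The gap is exactly the sum of the slacks of [f4], [f5], [f1], [f2], [f3], [hE] and [f6]. *)
rewrite -subr_ge0.
have -> : - 3 * (p + kappa * q) - (2 * (bt * ((s ^+ 2 - p) / 2) - bt * s * s + pE + bt * t * r)
    + kappa * (2 * (bt * ((t ^+ 2 - q) / 2) - bt * t * t + qE + x))) =
  (p * - 3 - p * (- (bt / 2) + (delta_c R n / n%:R - 1) + kappa * D))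
  + (kappa * q * - 3 - kappa * q * (- bt + (2 * n%:R - 1 - n%:R^-1) + 2 * D))
  + (bt * (p / 2 + kappa * t ^+ 2) - bt * (2 * (t * r)))
  + (kappa * ((2 * n%:R - 1 - n%:R^-1) * q) - kappa * (2 * qE))
  + (kappa * (D * (p + 2 * q)) - kappa * (2 * x))
  + ((delta_c R n / n%:R - 1) * p - 2 * pE) + bt * s ^+ 2.
  by field; rewrite gt_eqF// (lt_le_trans ltr01 n1).
by do 6![apply: addr_ge0; last by rewrite ?subr_ge0]; rewrite subr_ge0.
Qed.

(** For the term [-3 a A z]. It carries no factor [g], so it only affects the exponential factor and
    any constant will do; [|m| + 1] is taken to have a positive one. *)
Lemma lyap_drift : exists2 C, 0 < C & forall w e,
  `|bf Qi e (A *m (w + e))| <= C * lyap w e.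
Proof.
have sS : (A^T *m Qi *m A)^T = A^T *m Qi *m A.
  by rewrite !trmx_mul trmxK Qi_posdef.1 mulmxA.
have [m [_ [_ _ le]]] := rayleigh_max n0 (posdef1 R n) sS.
have L0 := Lambda_gt0 R n0; have k0 := kappa_gt0.
pose K := Num.sqrt (2 * L * (`|m| + 1)).
have K2 : K ^+ 2 = 2 * L * (`|m| + 1).
  by rewrite sqr_sqrtr// !mulr_ge0 ?addr_ge0// ltW.
have K0 : 0 < K by rewrite sqrtr_gt0 !mulr_gt0// ltr_wpDl.
exists (K * (1 + kappa^-1)).
  by rewrite mulr_gt0// addr_gt0// invr_gt0.
move=> w e.
have p0 : 0 <= bf P1 w w := (posdef_psd (P1_posdef R n)).2 w.
have q0 : 0 <= bf Qi e e := (posdef_psd Qi_posdef).2 e.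
have h : bf Qi (A *m (w + e)) (A *m (w + e)) <= K ^+ 2 * (bf P1 w w + bf Qi e e).
  have -> : bf Qi (A *m (w + e)) (A *m (w + e)) = bf (A^T *m Qi *m A) (w + e) (w + e).
    by rewrite bfMr bfMl trmxK.
  apply: (le_trans (le _)); rewrite K2.
  have I0 : 0 <= bf I (w + e) (w + e) := (posdef_psd (posdef1 R n)).2 _.
  apply: (@le_trans _ _ ((`|m| + 1) * bf I (w + e) (w + e))).
    by apply: ler_wpM2r => //; rewrite (le_trans (ler_norm m))// lerDl.
  rewrite (mulrC (2 * L)) -mulrA ler_wpM2l ?addr_ge0//; exact: bf1_sum_le.
apply: (le_trans (abs_Q1_inv_le (ltW K0) h)).
rewrite -!mulrA ler_pM2l// /lyap.
have -> : (1 + kappa^-1) * (bf P1 w w + kappa * bf Qi e e) =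
   bf P1 w w + kappa * bf Qi e e + kappa^-1 * bf P1 w w + bf Qi e e.
  by field; rewrite gt_eqF.
have : 0 <= kappa * bf Qi e e by rewrite mulr_ge0// ltW.
have : 0 <= kappa^-1 * bf P1 w w by rewrite mulr_ge0// invr_ge0 ltW.
lra.
Qed.

End LyapunovDecrease.

(** * The triangular perturbation and the constant [d] *)

Section Perturbation.
Variables (R : realType) (n : nat).
Implicit Types (g tau : R) (i j : 'I_n) (x f : 'cV[R]_n).
Local Notation A := (Amat R n).
Local Notation b := (bvec R n).
Local Notation c := (cvec R n).
Local Notation E := (Emat R n).
Local Notation I := (1%:M : 'M[R]_n).

Definition revdiag g : 'M[R]_n := diag_mx (\row_i g ^+ rev_ord i).

Lemma revdiagE g x i : (revdiag g *m x) i ord0 = g ^+ rev_ord i * x i ord0.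
Proof. by rewrite mul_diag_mx !mxE. Qed.

Lemma Emat_colE x i : (E *m x) i ord0 = (rev_ord i)%:R * x i ord0.
Proof.
rewrite mxE (bigD1 i) //= mxE eqxx mul1r big1 ?addr0 => [|j ji].
  have -> : (n.-1 - val i)%N = rev_ord i by have := ltn_ord i; rewrite /=; lia.
  by [].
by rewrite mxE eq_sym (negPf ji) !mul0r.
Qed.

Lemma bf1_sqr x : bf I x x = \sum_i x i ord0 ^+ 2.
Proof. by rewrite bf1E; apply: eq_bigr => i _; rewrite expr2. Qed.

(** Cauchy-Schwarz against the indicator of a row with [i + 1] entries; this is the factor [i]
    (counted from 1) in [d^2]. *)
Lemma sqr_sum_le (a : 'I_n -> R) i :
  (\sum_(j < n | (val j <= val i)%N) a j) ^+ 2 <=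
  i.+1%:R * \sum_(j < n | (val j <= val i)%N) a j ^+ 2.
Proof.
have := psd_CS (\col_j (val j <= val i)%N%:R) (\col_j ((val j <= val i)%N%:R * a j))
  (posdef_psd (posdef1 R n)).
have H (F G : 'I_n -> R) : (forall j, F j = if (val j <= val i)%N then G j else 0) ->
    \sum_j F j = \sum_(j < n | (val j <= val i)%N) G j.
  by move=> FG; rewrite [RHS]big_mkcond; apply: eq_bigr => j _; rewrite FG.
rewrite !bf1E (H _ a) => [|j]; last first.
  by rewrite !mxE; case: ifP; rewrite ?mul1r ?mul0r.
rewrite (H _ (fun=> 1)) => [|j]; last first.
  by rewrite !mxE; case: ifP; rewrite ?mul1r ?mul0r.
rewrite (H _ (fun j => a j ^+ 2)) => [|j]; last first.
  by rewrite !mxE; case: ifP; rewrite ?mul1r ?mul0r.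
have -> : \sum_(j < n | (j <= i)%N) 1 = i.+1%:R :> R.
  rewrite -[X in _ = X%:R]card_ord -sumr_const.
  exact: esym (big_ord_widen n (fun=> 1) (ltn_ord i)).
by [].
Qed.

Variables (cf : 'I_n -> 'I_n -> R) (T : R).

Lemma dconst_col j :
  \sum_(i < n | (val j <= val i)%N)
    (gcoef cf T i j * T ^+ (i - j)) ^+ 2 * i.+1%:R <= dconst cf T ^+ 2.
Proof.
rewrite /dconst sqr_sqrtr; last by elim/big_rec: _ => // k y _ y0; rewrite le_max y0 orbT.
apply: le_trans (le_bigmax _ _ j).
apply: ler_sum => i _; rewrite invrK exprMn -exprM mulnC.
by rewrite -!mulrA (mulrC _ i.+1%:R).
Qed.

Hypotheses (cf_ge0 : forall i j, 0 <= cf i j) (T_gt0 : 0 < T).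

(** In row [i] the scaling turns [c_ij |x_j|] into [c_ij tau^(2(i-j)+1) |z_j|]. Since [j <= i] the
    exponent is positive, so [tau] may be replaced by [T], which yields a bound uniform in time. *)
Lemma perturbation_le tau x f z psi : 0 < tau -> tau <= T ->
  (forall i, `|f i ord0| <= \sum_(j < n | (val j <= val i)%N) cf i j * `|x j ord0|) ->
  z = revdiag tau^-1 *m revdiag tau^-1 *m x ->
  psi = E *m z + tau *: (revdiag tau^-1 *m revdiag tau^-1 *m f) ->
  bf I psi psi <= dconst cf T ^+ 2 * bf I z z.
Proof.
set L2 := revdiag _ *m _ => tau0 tauT hf zE psiE.
have L2E (y : 'cV[R]_n) i : (L2 *m y) i ord0 = tau^-1 ^+ (2 * rev_ord i) * y i ord0.
  by rewrite /L2 -mulmxA !revdiagE mulrA -exprD addnn mul2n.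
pose G i j := gcoef cf T i j * T ^+ (i - j).
have GE i j : (j <= i)%N ->
    G i j = cf i j * T ^+ (2 * (i - j)).+1 + (j == i)%:R * (rev_ord i)%:R.
  move=> ji; rewrite /G /gcoef; case: ltnP => [lt|ij].
    have -> : (j == i) = false by apply/eqP => ji'; rewrite ji' ltnn in lt.
    by rewrite mul0r addr0 -mulrA -exprD addSn addnn mul2n.
  have -> : j = i by apply: val_inj; apply/eqP; rewrite eqn_leq ji ij.
  by rewrite !eqxx subnn muln0 expr0 mulr1 mul1r expr1.
have key i : `|psi i ord0| <= \sum_(j < n | (val j <= val i)%N) G i j * `|z j ord0|.
  have -> : \sum_(j < n | (val j <= val i)%N) G i j * `|z j ord0| =
     \sum_(j < n | (val j <= val i)%N) cf i j * T ^+ (2 * (i - j)).+1 * `|z j ord0|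
     + (rev_ord i)%:R * `|z i ord0|.
    rewrite (eq_bigr (fun j => cf i j * T ^+ (2 * (i - j)).+1 * `|z j ord0| +
       (j == i)%:R * (rev_ord i)%:R * `|z j ord0|)) => [|j ji]; last by rewrite GE// mulrDl.
    rewrite big_split /=; congr (_ + _).
    rewrite (bigD1 i) //= eqxx mul1r big1 ?addr0// => j /andP[_ /negPf ->].
    by rewrite !mul0r.
  rewrite psiE mxE Emat_colE mxE L2E addrC; apply: (le_trans (ler_normD _ _)).
  rewrite lerD//; last by rewrite normrM ger0_norm.
  have tp : 0 < tau^-1 by rewrite invr_gt0.
  rewrite !normrM (gtr0_norm tau0) (gtr0_norm (exprn_gt0 _ tp)).
  rewrite mulrA; apply: (@le_trans _ _ (tau * tau^-1 ^+ (2 * rev_ord i) *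
     \sum_(j < n | (val j <= val i)%N) cf i j * `|x j ord0|)).
    by apply: ler_wpM2l => //; rewrite mulr_ge0 ?exprn_ge0// ltW.
  rewrite mulr_sumr; apply: ler_sum => j ji.
  rewrite mulrCA -mulrA; apply: ler_wpM2l => //.
  have -> : `|z j ord0| = tau^-1 ^+ (2 * rev_ord j) * `|x j ord0|.
    by rewrite zE L2E normrM (gtr0_norm (exprn_gt0 _ tp)).
  have -> : (2 * rev_ord j = 2 * rev_ord i + 2 * (i - j))%N.
    by move: ji (ltn_ord i) => /=; lia.
  rewrite mulrA; apply: ler_wpM2r => //.
  rewrite exprD mulrCA [leLHS]mulrC ler_pM2l; last by rewrite exprn_gt0.
  rewrite exprVn -ler_pdivrMr ?invr_gt0 ?exprn_gt0// invrK -exprS.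
  by rewrite lerXn2r// nnegrE ltW.
rewrite !bf1_sqr mulr_sumr.
apply: (@le_trans _ _ (\sum_i \sum_(j < n | (val j <= val i)%N)
    (G i j ^+ 2 * i.+1%:R) * z j ord0 ^+ 2)).
  apply: ler_sum => i _; apply: (@le_trans _ _
     ((\sum_(j < n | (val j <= val i)%N) G i j * `|z j ord0|) ^+ 2)).
    rewrite -(@real_normK _ (psi i ord0)) ?num_real// lerXn2r// nnegrE//.
    exact: le_trans (key i).
  apply: (le_trans (sqr_sum_le _ _)); rewrite mulr_sumr; apply: ler_sum => j _.
  by rewrite exprMn real_normK ?num_real// mulrA (mulrC i.+1%:R).
(* Exchanging the sums turns row estimates into column sums, hence the maximum over [j] in [d^2]. *)
rewrite (exchange_big_dep xpredT) //=; apply: ler_sum => j _.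
rewrite -mulr_suml; apply: ler_wpM2r; first exact: sqr_ge0.
exact: dconst_col.
Qed.

End Perturbation.

(** * Derivatives of the scaled quantities and a comparison principle *)

Section Derivatives.
Variables (R : realType) (n : nat).
Implicit Types (T t s : R) (v w : R -> 'cV[R]_n) (dv dw : 'cV[R]_n).

Definition is_vderive t v dv :=
  forall i, is_derive t 1 (fun s => v s i ord0) (dv i ord0).

Lemma is_derive_vderive t v dv : is_derive t 1 v dv -> is_vderive t v dv.
Proof.
move=> [d <-] i; split; first exact: (derivable_mxP v t 1).1.
by rewrite derive_mx// mxE.
Qed.

Lemma is_vderiveB t v w dv dw : is_vderive t v dv -> is_vderive t w dw ->
  is_vderive t (fun s => v s - w s) (dv - dw).
Proof.
move=> hv hw i; rewrite !mxE.
have -> : (fun s => (v s - w s) i ord0) =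
    (fun s => v s i ord0) - (fun s => w s i ord0) by apply/funext => s; rewrite !mxE.
by apply: is_deriveB.
Qed.

Lemma is_derive_bf (M : 'M[R]_n) t v dv : M^T = M -> is_vderive t v dv ->
  is_derive t 1 (fun s => bf M (v s) (v s)) (2 * bf M (v t) dv).
Proof.
move=> sM hv.
have -> : (fun s => bf M (v s) (v s)) =
    \sum_i \sum_j (M i j *: ((fun s => v s i ord0) * (fun s => v s j ord0))).
  apply/funext => s; rewrite bfE fct_sumE; apply: eq_bigr => i _.
  by rewrite fct_sumE; apply: eq_bigr => j _; rewrite -mulrA.
apply: is_derive_eq.
  apply: is_derive_sum => i; apply: is_derive_sum => j.
  by apply: is_deriveZ; apply: is_deriveM; apply: hv.
have -> : 2 * bf M (v t) dv = bf M (v t) dv + bf M dv (v t).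
  by rewrite (bfC dv _ sM); ring.
rewrite !bfE -big_split; apply: eq_bigr => i _.
rewrite -big_split; apply: eq_bigr => j _ /=.
by rewrite /GRing.scale /=; ring.
Qed.

Lemma is_derive_gain T t : T - t != 0 ->
  is_derive t 1 (fun s => (T - s)^-1) ((T - t)^-1 ^+ 2).
Proof.
move=> Tt.
have h : is_derive t 1 (fun s => T - s) (0 - 1).
  exact: is_deriveB (is_derive_cst T t 1) (is_derive_id t 1).
have h2 := @is_deriveV _ (fun s => T - s) _ _ _ Tt h.
apply: (is_derive_eq h2).
by rewrite sub0r scalerN scaleNr opprK /GRing.scale /= mulr1 exprVn.
Qed.

Lemma is_derive_gainX T t k : T - t != 0 ->
  is_derive t 1 (fun s => (T - s)^-1 ^+ k) (k%:R * (T - t)^-1 ^+ k.+1).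
Proof.
case: k => [|k] Tt.
  by rewrite mul0r; apply: is_derive_cst.
have h := is_derive_gain Tt.
have -> : (fun s => (T - s)^-1 ^+ k.+1) = (fun s => (T - s)^-1) ^+ k.+1.
  by apply/funext => s; rewrite fctE.
apply: (is_derive_eq (@is_deriveX _ _ _ k.+1 _ _ _ h)).
by rewrite /GRing.scale /= -mulrA -exprD addn2.
Qed.

(** With [g' = g^2], the entry [g^(n-1-i)] of [L] has derivative [(n-1-i) g * g^(n-1-i)], so
    [L' = g E L]. *)
Lemma is_vderive_revdiag T t v dv : T - t != 0 -> is_vderive t v dv ->
  is_vderive t (fun s => revdiag n (T - s)^-1 *m v s)
    (revdiag n (T - t)^-1 *m dv
     + (T - t)^-1 *: (Emat R n *m (revdiag n (T - t)^-1 *m v t))).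
Proof.
move=> Tt hv i.
have -> : (fun s => (revdiag n (T - s)^-1 *m v s) i ord0) =
    (fun s => (T - s)^-1 ^+ rev_ord i) * (fun s => v s i ord0).
  by apply/funext => s; rewrite revdiagE.
apply: (is_derive_eq (is_deriveM (is_derive_gainX (rev_ord i) Tt) (hv i))).
by rewrite mxE revdiagE mxE Emat_colE revdiagE /GRing.scale /= exprS; ring.
Qed.

Lemma derive_le0_le T (f df : R -> R) t : 0 <= t < T ->
  (forall s, 0 <= s < T -> is_derive s 1 f (df s)) ->
  (forall s, 0 <= s < T -> df s <= 0) -> f t <= f 0.
Proof.
move=> /andP[t0 tT] fD f0.
have D s : s \in `[0, t] -> is_derive s 1 f (df s).
  by rewrite in_itv /= => /andP[s0 st]; apply: fD; rewrite s0 (le_lt_trans st).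
apply: (@ler0_derive1_le_cc _ f 0 t) => //.
- by move=> s /subset_itv_oo_cc/D[].
- move=> s ss; rewrite derive1E; have /D [_ ->] := subset_itv_oo_cc ss.
  apply: f0; move: ss; rewrite in_itv /= => /andP[/ltW -> st].
  exact: lt_trans tT.
- by apply: derivable_within_continuous => s /D[].
- by rewrite in_itv /= lexx t0.
- by rewrite in_itv /= lexx t0.
Qed.

(** [(T - s)^-3 exp(- K s)] is an integrating factor: its product with [W] is nonincreasing. *)
Lemma gronwall_gain T (W dW : R -> R) K t : 0 <= t < T ->
  (forall s, 0 <= s < T -> is_derive s 1 W (dW s)) ->
  (forall s, 0 <= s < T -> dW s <= (- 3 * (T - s)^-1 + K) * W s) ->
  W t <= W 0 * ((T - t) / T) ^+ 3 * expR (K * t).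
Proof.
move=> tT WD Wle.
have Ts s : 0 <= s < T -> 0 < T - s by move=> /andP[_]; rewrite subr_gt0.
pose G := (W * (fun s => (T - s)^-1 ^+ 3)) * (expR \o (fun s => - K * s)).
pose dG s := (T - s)^-1 ^+ 3 * expR (- K * s) * (dW s - (- 3 * (T - s)^-1 + K) * W s).
have GD s : 0 <= s < T -> is_derive s 1 G (dG s).
  move=> sT; have hs := is_derive_gainX 3 (lt0r_neq0 (Ts _ sT)).
  have hl : is_derive s 1 (fun s => - K * s) (- K * 1).
    exact: (@is_deriveZ _ _ _ id (- K) s 1 1 (is_derive_id s 1)).
  have he := is_derive1_comp (is_derive_expR (- K * s)) hl.
  apply: (is_derive_eq (is_deriveM (is_deriveM (WD _ sT) hs) he)).
  by rewrite /dG /GRing.scale mulrfctE /=; ring.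
have : G t <= G 0.
  apply: derive_le0_le tT GD _ => s sT.
  rewrite pmulr_rle0 ?subr_le0 ?Wle//.
  by rewrite mulr_gt0 ?expR_gt0// exprn_gt0// invr_gt0 Ts.
have T0 : 0 < T by case/andP: tT => t0 /(le_lt_trans t0).
have Gt s : G s = W s * (T - s)^-1 ^+ 3 * expR (- K * s) by [].
rewrite !Gt mulr0 expR0 mulr1 subr0 => h.
have -> : W t = W t * (T - t)^-1 ^+ 3 * expR (- K * t) * ((T - t) ^+ 3 * expR (K * t)).
  rewrite mulNr expRN; field.
  by rewrite gt_eqF ?expR_gt0//= gt_eqF// Ts.
have -> : W 0 * ((T - t) / T) ^+ 3 * expR (K * t) =
    W 0 * T^-1 ^+ 3 * ((T - t) ^+ 3 * expR (K * t)).
  by field; rewrite gt_eqF.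
apply: ler_wpM2r => //.
by rewrite mulr_ge0 ?expR_ge0// exprn_ge0// ltW// Ts.
Qed.

End Derivatives.

(** * The closed loop in scaled variables *)

Section ScaledDynamics.
Variables (R : realType) (n : nat).
Implicit Types (g bt a : R) (x xi f : 'cV[R]_n).
Local Notation A := (Amat R n).
Local Notation b := (bvec R n).
Local Notation c := (cvec R n).
Local Notation E := (Emat R n).
Local Notation Q1 := (riccQ R n).
Local Notation P1 := (riccP R n).
Local Notation J := (rev_mx R n).
Local Notation L := (revdiag n).
Local Notation qc := (Q1 *m c^T).

Lemma revdiag_tr g : (L g)^T = L g.
Proof. exact: tr_diag_mx. Qed.

Lemma revdiag_Amat g : L g *m A = g *: (A *m L g).
Proof.
apply/matrixP => i j; rewrite mul_diag_mx [RHS]mxE mul_mx_diag !mxE.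
have [ji|_] := eqVneq (val j) i.+1; last by rewrite mul0r !mulr0.
rewrite mul1r mulr1 -exprS; congr (_ ^+ _).
by move: ji (ltn_ord j) => /=; lia.
Qed.

Lemma revdiag_bvec g : L g *m b = b.
Proof.
apply/matrixP => i j; rewrite mul_diag_mx !mxE.
have [ib|_] := eqVneq (val i) n.-1; last by rewrite mulr0.
have -> : val (rev_ord i) = 0%N by move: ib (ltn_ord i) => /=; lia.
by rewrite mul1r.
Qed.

Lemma cvec_revdiag g : c *m L g = g ^+ n.-1 *: c.
Proof.
apply/rowP => j; rewrite mul_mx_diag !mxE.
have [jb|_] := eqVneq (val j) 0%N; last by rewrite mul0r mulr0.
have -> : val (rev_ord j) = n.-1 by move: jb (ltn_ord j) => /=; lia.
by rewrite mulrC.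
Qed.

Lemma revdiag_powdiag g : L g *m powdiag n g = (g ^+ n.-1)%:M.
Proof.
apply/matrixP => i j; rewrite mul_diag_mx !mxE.
have [->|_] := eqVneq i j; last by rewrite mulr0.
by rewrite !mulr1n -exprD; congr (_ ^+ _); have := ltn_ord j; rewrite /=; lia.
Qed.

Lemma rev_powdiag g : J *m powdiag n g *m J = L g.
Proof.
apply/matrixP => i j; rewrite mul_rev_mxE rev_mx_mulE !mxE.
by rewrite (inj_eq rev_ord_inj).
Qed.

Lemma Pmat_revdiag g : 0 < g -> Pmat n g = g *: (L g *m P1 *m L g).
Proof.
move=> g0; rewrite PmatE// QmatE// -scalemxAr -scalemxAl; congr (_ *: _).
by rewrite -rev_powdiag /riccP !mulmxA !mul_rev_mxK.
Qed.

Lemma revdiag_Qmat g : 0 < g -> L g *m (Qmat n g *m c^T) = g ^+ n.-1.+1 *: qc.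
Proof.
move=> g0; rewrite QmatE// -scalemxAl -mulmxA powdiag_cvec -mulmxA -scalemxAr.
by rewrite (mulmxA (L g)) revdiag_powdiag mul_scalar_mx scalerA -exprS.
Qed.

Lemma Emat_revdiag g : E *m L g = L g *m E.
Proof.
apply/matrixP => i j; rewrite mul_mx_diag mul_diag_mx !mxE.
by have [->|_] := eqVneq i j; rewrite ?mul0r ?mulr0// mulrC.
Qed.

Lemma mulmx_11 (v : 'cV[R]_n) (r : 'M[R]_1) : v *m r = r ord0 ord0 *: v.
Proof. by rewrite [r]mx11_scalar mul_mx_scalar mxE eqxx mulr1n. Qed.

Section Rates.
Variables (g bt a u0 : R) (x xi f : 'cV[R]_n).
Hypothesis (g0 : 0 < g) (u0E : u0 * g ^+ 2 = bt * g - 3 * a).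
Let om := L g *m xi.
Let ze := L g *m (L g *m x).
Let e := ze - om.
Let u := - bt * (b^T *m Pmat n g *m xi) ord0 ord0.
Let dx := u0 *: (A *m x) + u *: b + f.
Let dxi := bt *: (A *m xi) + u *: b
  + bt *: (Qmat n g *m c^T) *m (g ^+ n.-1 *: (c *m x) - c *m xi).
(** [dom] and [dze] are what the product rule gives for the derivatives of [w] and [z]. Time is
    frozen, so that only matrix algebra remains. *)
Let dom := L g *m dxi + g *: (E *m om).
Let dze := L g *m (L g *m dx + g *: (E *m (L g *m x))) + g *: (E *m ze).

Lemma scaled_input : u = - bt * (g * bf P1 b om).
Proof.
rewrite /u Pmat_revdiag// -scalemxAr -scalemxAl mxE; congr (_ * (_ * _)).
rewrite /bf /om !mulmxA; congr ((_ *m _ *m _ *m _) _ _).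
by rewrite -{1}revdiag_tr -trmx_mul revdiag_bvec.
Qed.

(** The output gain fits because [L Q(g) c^T = g^n Q c^T], while [c e] is [g^(n-1)] times the
    innovation [g^(n-1) c x - c xi]: exactly one [g] is left in front. *)
Lemma scaled_observer :
  dom = g *: (bt *: (A *m om) - (bt * bf P1 b om) *: b + E *m om
               + (bt * (c *m e) ord0 ord0) *: qc).
Proof.
rewrite /dom /dxi scaled_input.
have -> : bt *: (Qmat n g *m c^T) *m (g ^+ n.-1 *: (c *m x) - c *m xi) =
    (bt * (g ^+ n.-1 * (c *m x) ord0 ord0 - (c *m xi) ord0 ord0)) *: (Qmat n g *m c^T).
  by rewrite mulmx_11 scalerA mulrC; congr ((_ * _) *: _); rewrite !mxE.
have -> : (c *m e) ord0 ord0 =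
    g ^+ n.-1 * (g ^+ n.-1 * (c *m x) ord0 ord0 - (c *m xi) ord0 ord0).
  rewrite /e mulmxBr /ze /om !mulmxA cvec_revdiag -!scalemxAl cvec_revdiag.
  by rewrite -scalemxAl !mxE mulrBr.
set k := _ - _ ord0 ord0.
rewrite !mulmxDr -!scalemxAr revdiag_bvec revdiag_Qmat// mulmxA revdiag_Amat.
rewrite -scalemxAl -mulmxA -/om exprS.
move: (A *m om) (E *m om) (bf P1 b om) qc (g ^+ n.-1) k => v1 v2 s v3 y k.
by apply/colP => i; rewrite !mxE; ring.
Qed.

(** The input cancels, since [L b = b] makes it enter [z] and [w] identically. [L^2 A x = g^2 A z]
    turns [u0] into [beta g - 3 a], and of the two copies of [E z] one pairs with [E w] to give
    [E e]. *)
Lemma scaled_error :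
  dze - dom = g *: (bt *: (A *m e) - (bt * (c *m e) ord0 ord0) *: qc + E *m e
    + (E *m ze + g^-1 *: (L g *m L g *m f))) - (3 * a) *: (A *m ze).
Proof.
rewrite scaled_observer /dze /dx scaled_input.
have LA : L g *m (L g *m (A *m x)) = g ^+ 2 *: (A *m ze).
  rewrite [L g *m (A *m x)]mulmxA revdiag_Amat -scalemxAl -scalemxAr -mulmxA.
  by rewrite [L g *m (A *m _)]mulmxA revdiag_Amat -scalemxAl -mulmxA scalerA.
have LE : L g *m (E *m (L g *m x)) = E *m ze.
  by rewrite mulmxA -Emat_revdiag -mulmxA.
have : ze = e + om by rewrite subrK.
move: (e) => d zeE; rewrite !mulmxDr -!scalemxAr LA LE !revdiag_bvec -(mulmxA (L g)).
have -> : A *m ze = A *m d + A *m om by rewrite zeE mulmxDr.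
have -> : E *m ze = E *m d + E *m om by rewrite zeE mulmxDr.
rewrite scalerA u0E.
move: (A *m d) (A *m om) (E *m d) (E *m om) (bf P1 b om) qc ((c *m d) ord0 ord0)
  (L g *m (L g *m f)) => v1 v2 v3 v4 s v5 y v6.
apply/colP => i; rewrite !mxE; field.
by rewrite gt_eqF.
Qed.

End Rates.
End ScaledDynamics.

(** * Passage between the Lyapunov function and Euclidean norms *)

Section Estimates.
Variables (R : realType) (n : nat).
Hypothesis n0 : (0 < n)%N.
Implicit Types (g h a bt T t : R) (v w e x xi psi : 'cV[R]_n).
Local Notation A := (Amat R n).
Local Notation b := (bvec R n).
Local Notation c := (cvec R n).
Local Notation E := (Emat R n).
Local Notation Q1 := (riccQ R n).
Local Notation Qi := (invmx Q1).
Local Notation P1 := (riccP R n).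
Local Notation L := (revdiag n).
Local Notation Lam := (Lambda R n).
Local Notation kap := (kappa R n).
Local Notation qc := (Q1 *m c^T).
Local Notation I := (1%:M : 'M[R]_n).

Lemma enorm_sqr v : enorm v ^+ 2 = bf I v v.
Proof. by rewrite bf1_sqr sqr_sqrtr// sumr_ge0// => i _; exact: sqr_ge0. Qed.

Lemma enorm_ge0 v : 0 <= enorm v.
Proof. exact: sqrtr_ge0. Qed.

(** The base [1 + h] is at least 1, so one power dominates all exponents [0, ..., n-1] whether [h]
    is below or above 1. *)
Lemma revdiag_le g h v : 0 <= g <= h ->
  bf I (L g *m v) (L g *m v) <= (1 + h) ^+ n ^+ 2 * bf I v v.
Proof.
move=> /andP[g0 gh]; rewrite !bf1_sqr mulr_sumr; apply: ler_sum => i _.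
rewrite revdiagE exprMn; apply: ler_wpM2r; first exact: sqr_ge0.
have h0 : 0 <= h by exact: le_trans gh.
rewrite lerXn2r ?nnegrE ?exprn_ge0 ?addr_ge0//.
apply: (@le_trans _ _ ((1 + h) ^+ rev_ord i)).
  by rewrite lerXn2r ?nnegrE ?addr_ge0// (le_trans gh)// lerDr.
by apply: ler_weXn2l; rewrite ?lerDl//; exact: leq_subr.
Qed.

Lemma revdiagK g v : g != 0 -> L g *m (L g^-1 *m v) = v.
Proof.
move=> gN0; apply/colP => i; rewrite !revdiagE mulrA -exprMn divff// expr1n.
by rewrite mul1r.
Qed.

Lemma lyap_ge0 w e : 0 <= lyap w e.
Proof.
rewrite addr_ge0 ?(posdef_psd (P1_posdef R n)).2// mulr_ge0 ?(ltW (kappa_gt0 R n0))//.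
exact: (posdef_psd (Qi_posdef R n)).2.
Qed.

Lemma bf_P1_le_lyap w e : bf P1 w w <= lyap w e.
Proof.
rewrite lerDl mulr_ge0 ?(ltW (kappa_gt0 R n0))//.
exact: (posdef_psd (Qi_posdef R n)).2.
Qed.

Lemma observer_le_lyap w e : bf I w w <= Lam * lyap w e.
Proof.
apply: (le_trans (P1_ge n0 w)); apply: ler_wpM2l; last exact: bf_P1_le_lyap.
exact/ltW/Lambda_gt0.
Qed.

Lemma state_le_lyap w e :
  bf I (w + e) (w + e) <= 2 * Lam * (1 + kap^-1) * lyap w e.
Proof.
have k0 := kappa_gt0 R n0.
apply: (le_trans (bf1_sum_le n0 w e)); rewrite -[leRHS]mulrA; apply: ler_wpM2l.
  by rewrite mulr_ge0// ltW// Lambda_gt0.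
rewrite /lyap; set p := bf P1 w w; set q := bf Qi e e.
have p0 : 0 <= p := (posdef_psd (P1_posdef R n)).2 w.
have q0 : 0 <= q := (posdef_psd (Qi_posdef R n)).2 e.
have -> : (1 + kap^-1) * (p + kap * q) = p + q + (kap^-1 * p + kap * q).
  by field; rewrite gt_eqF.
by rewrite lerDl addr_ge0// mulr_ge0 ?invr_ge0 ?(ltW k0).
Qed.

Lemma input_le_lyap w e : bf P1 b w ^+ 2 <= (bf P1 b b + 1) * lyap w e.
Proof.
have pP := posdef_psd (P1_posdef R n).
apply: (le_trans (psd_CS b w pP)); apply: ler_pM; [exact: pP.2|exact: pP.2|by rewrite lerDl|].
exact: bf_P1_le_lyap.
Qed.

Lemma lyap_le w x :
  lyap w (x - w) <= Lam * (1 + 2 * kap) * (bf I w w + bf I x x).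
Proof.
have k0 := kappa_gt0 R n0; have L0 := Lambda_gt0 R n0.
have pI := posdef_psd (posdef1 R n).
have h1 := P1_le n0 w; have h2 := Q1_inv_le n0 (x - w).
have := psd_sqD x (- w) pI; rewrite [bf I (- w) _]bfNl [bf I w (- w)]bfNr opprK => h3.
have p0 : 0 <= bf I w w := pI.2 w.
have q0 : 0 <= bf I x x := pI.2 x.
have h4 : kap * bf Qi (x - w) (x - w) <= kap * (Lam * (2 * (bf I x x + bf I w w))).
  by rewrite ler_pM2l// (le_trans h2)// ler_pM2l.
have h5 : 0 <= Lam * bf I x x by rewrite mulr_ge0// ltW.
rewrite /lyap; set p := bf I w w in h1 h4 *; set q := bf I x x in h4 h5 *.
have -> : Lam * (1 + 2 * kap) * (p + q) =
   Lam * p + kap * (Lam * (2 * (q + p))) + Lam * q by ring.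
lra.
Qed.

Lemma lyap_rate g bt a C d w e z psi Y X :
  z = w + e -> 0 <= g -> 0 <= d ->
  (forall v u, `|bf Qi u (A *m (v + u))| <= C * lyap v u) ->
  8 * Num.sqrt 2 * n%:R * d * Lam * (kap / 2) + 2 * (2 + delta_c R n / n%:R) <= bt ->
  4 * Num.sqrt 2 * d * Lam + 2 * (2 * n%:R + 2 - n%:R^-1) <= bt ->
  bf I psi psi <= d ^+ 2 * bf I z z ->
  Y = bt *: (A *m w) - (bt * bf P1 b w) *: b + E *m w
               + (bt * (c *m e) ord0 ord0) *: qc ->
  X = bt *: (A *m e) - (bt * (c *m e) ord0 ord0) *: qc + E *m e + psi ->
  2 * bf P1 w (g *: Y) + kap * (2 * bf Qi e (g *: X - (3 * a) *: (A *m z)))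
  <= (- 3 * g + 6 * kap * C * `|a|) * lyap w e.
Proof.
move=> -> g0 d0 HC h1 h2 hpsi YE XE.
have k0 := kappa_gt0 R n0.
have D := lyap_decrease n0 d0 h1 h2 hpsi; rewrite -YE -XE in D.
rewrite bfZr bfDr bfNr !bfZr.
have := ler_wpM2l g0 D.
have : - a * bf Qi e (A *m (w + e)) <= `|a| * (C * lyap w e).
  apply: (le_trans (ler_norm _)); rewrite normrM normrN.
  by apply: ler_wpM2l => //; exact: HC.
set t := bf Qi e (A *m (w + e)); set y := bf P1 w Y; set x := bf Qi e X.
set W := lyap w e => f1 f2.
have f3 : 6 * kap * (- a * t) <= 6 * kap * (`|a| * (C * W)).
  by apply: ler_wpM2l => //; rewrite mulr_ge0// ltW.
lra.
Qed.

Lemma le_sqrt_expR (y B M N F tau W : R) : 0 <= y -> 0 <= B -> 0 <= M -> 0 <= N ->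
  0 < tau -> y ^+ 2 <= B * W -> W <= M * N ^+ 2 * expR (2 * F) * tau ^+ 3 ->
  y <= Num.sqrt (B * M) * expR F * powR tau (3 / 2) * N.
Proof.
move=> y0 B0 M0 N0 t0 yW WM.
have r0 : 0 <= Num.sqrt (B * M) * expR F * powR tau (3 / 2) * N.
  by rewrite !mulr_ge0 ?sqrtr_ge0 ?expR_ge0 ?powR_ge0.
rewrite -ler_sqr ?nnegrE//; apply: (le_trans yW).
apply: (le_trans (ler_wpM2l B0 WM)).
have e : powR tau (3 / 2) ^+ 2 = tau ^+ 3.
  rewrite -(powR_mulrn 2 (powR_ge0 _ _)) -powRrM divfK ?pnatr_eq0//.
  by rewrite powR_mulrn// ltW.
rewrite !exprMn e sqr_sqrtr ?mulr_ge0// expRM_natl.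
by rewrite le_eqVlt; apply/orP; left; apply/eqP; ring.
Qed.

Lemma powR_half (tau : R) : 0 < tau -> tau^-1 * powR tau (3 / 2) = powR tau (1 / 2).
Proof.
move=> t0; have -> : 3 / 2 = 1 + 1 / 2 :> R by field.
rewrite powRD; last by rewrite gt_eqF ?implybT.
by rewrite powRr1 ?(ltW t0)// mulrA mulVf ?mul1r ?gt_eqF.
Qed.

End Estimates.

(** * Choice of the constants and assembly of the closed-loop estimates *)

Theorem theorem2 (R : realType) (n : nat) (n_gt0 : (0 < n)%N)
  (c : 'I_n -> 'I_n -> R) (c_ge0 : forall i j, 0 <= c i j)
  (phi : 'I_n -> R -> R -> R -> 'cV[R]_n -> R)
  (phi_cont : forall i,
     continuous (fun p : R * R * R * 'cV[R]_n => phi i p.1.1.1 p.1.1.2 p.1.2 p.2))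
  (phi_bound : forall i t u0 u (x : 'cV[R]_n),
     `|phi i t u0 u x| <= \sum_(j < n | (val j <= val i)%N) c i j * `|x j ord0|)
  (T : R) (T_gt0 : 0 < T) :
  let bt := @beta R n c T in
  let gam := fun t : R => T / (T - t) * T^-1 in
  exists (v3 v30 v4 v40 v5 v50 : R),
    [/\ 0 < v3, 0 < v30, 0 < v4 & 0 < v40] /\ (0 < v5 /\ 0 < v50) /\
    forall (x0 : R -> R) (x xi : R -> 'cV[R]_n),
    let u0 := fun t => - (3 / (T - t)) * x0 t - bt / 2 * (T - t) in
    let u := fun t => - bt * ((@bvec R n)^T *m @Pmat R n (gam t) *m xi t) ord0 ord0 in
    (forall t, 0 <= t < T ->
       [/\ is_derive t 1 x0 (u0 t),
           is_derive t 1 x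
             (u0 t *: (@Amat R n *m x t) + u t *: @bvec R n
              + \col_i phi i t (u0 t) (u t) (x t)) &
           is_derive t 1 xi
             (bt *: (@Amat R n *m xi t) + u t *: @bvec R n
              + bt *: (@Qmat R n (gam t) *m (@cvec R n)^T)
                  *m (gam t ^+ n.-1 *: (@cvec R n *m x t) - @cvec R n *m xi t))]) ->
    forall t, 0 <= t < T ->
      [/\ `|x0 t| <= (T - t) ^+ 2 * ((T - t) / T ^+ 3 * `|x0 0| + bt * t / (2 * T)),
          `|u0 t| <= (T - t) * (3 * (T - t) * (`|x0 0| / T ^+ 3 + bt / (2 * T)) + bt),
          @enorm R n (x t) <= v3 * expR (v30 * `|x0 0| * t) * powR (T - t) (3 / 2)
                          * (@enorm R n (x 0) + @enorm R n (xi 0)),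
          @enorm R n (xi t) <= v4 * expR (v40 * `|x0 0| * t) * powR (T - t) (3 / 2)
                          * (@enorm R n (x 0) + @enorm R n (xi 0)) &
          `|u t| <= v5 * expR (v50 * `|x0 0| * t) * powR (T - t) (1 / 2)
                          * (@enorm R n (x 0) + @enorm R n (xi 0))].
Proof.
move=> bt gam.
have [C0 C0_gt0 HC] := lyap_drift R n_gt0.
have L0 := Lambda_gt0 R n_gt0; have k0 := kappa_gt0 R n_gt0.
pose d := dconst c T.
have d0 : 0 <= d by exact: sqrtr_ge0.
have n1 : 1 <= n%:R :> R by rewrite ler1n.
have in1 : n%:R^-1 <= 1 :> R by rewrite invf_le1// ltr0n.
have hb1 : 8 * Num.sqrt 2 * n%:R * d * Lambda R n * (kappa R n / 2)
    + 2 * (2 + delta_c R n / n%:R) <= bt by rewrite /bt /beta -kappaE le_max lexx.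
have hb2 : 4 * Num.sqrt 2 * d * Lambda R n + 2 * (2 * n%:R + 2 - n%:R^-1) <= bt.
  by rewrite /bt /beta le_max lexx orbT.
have bt_gt0 : 0 < bt.
  apply: lt_le_trans hb2; apply: ltr_wpDl; last lra.
  by rewrite !mulr_ge0 ?sqrtr_ge0// ltW.
pose m0 := (1 + T^-1) ^+ n ^+ 2; pose m1 := (1 + T) ^+ n ^+ 2.
pose c1 := 6 * kappa R n * C0.
pose M := Lambda R n * (1 + 2 * kappa R n) * (m0 + m0 ^+ 2) / T ^+ 3 * expR (c1 * (bt / 2)).
pose v := c1 / (2 * T ^+ 3).
pose B3 := m1 ^+ 2 * (2 * Lambda R n * (1 + (kappa R n)^-1)).
pose B4 := m1 * Lambda R n.
pose B5 := bf (riccP R n) (bvec R n) (bvec R n) + 1.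
have Ti_gt0 : 0 < T^-1 by rewrite invr_gt0.
have m0_gt0 : 0 < m0 by rewrite !exprn_gt0// addr_gt0.
have m1_gt0 : 0 < m1 by rewrite !exprn_gt0// addr_gt0.
have c1_gt0 : 0 < c1 by rewrite /c1 mulr_gt0// mulr_gt0.
have M_gt0 : 0 < M.
  rewrite mulr_gt0 ?expR_gt0// divr_gt0 ?exprn_gt0// mulr_gt0//.
    by rewrite mulr_gt0// addr_gt0// mulr_gt0.
  by rewrite addr_gt0// exprn_gt0.
have v_gt0 : 0 < v by rewrite divr_gt0// mulr_gt0// exprn_gt0.
have B3_gt0 : 0 < B3.
  by rewrite /B3 mulr_gt0 ?exprn_gt0 ?mulr_gt0 ?addr_gt0 ?invr_gt0.
have B4_gt0 : 0 < B4 by rewrite mulr_gt0.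
have B5_gt0 : 0 < B5.
  by rewrite ltr_wpDl// (posdef_psd (P1_posdef R n)).2.
have sqrt_gt0 B : 0 < B -> 0 < Num.sqrt (B * M) by move=> B0; rewrite sqrtr_gt0 mulr_gt0.
exists (Num.sqrt (B3 * M)), v, (Num.sqrt (B4 * M)), v, (bt * Num.sqrt (B5 * M)), v.
split; first by split=> //; rewrite sqrt_gt0.
split; first by split=> //; rewrite mulr_gt0 ?sqrt_gt0.
move=> x0 x xi u0 u ode t tT.
have Ts s : 0 <= s < T -> 0 < T - s by move=> /andP[_]; rewrite subr_gt0.
have tau_gt0 := Ts _ tT.
have [t0 ltT] := andP tT.
have T0 : 0 <= (0 : R) < T by rewrite lexx.
have gamE s : gam s = (T - s)^-1.
  by rewrite /gam mulrAC divff ?gt_eqF// mul1r.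
have x0E s : 0 <= s < T ->
    x0 s = (T - s) ^+ 3 / T ^+ 3 * x0 0 - (T - s) ^+ 2 * (bt * s / (2 * T)).
  move=> sT.
  pose G := x0 * (fun r => (T - r)^-1 ^+ 3) + (bt / 2) \*: (fun r => (T - r)^-1 ^+ 1).
  have GD r : 0 <= r < T -> is_derive r 1 G 0.
    move=> rT; have Tr := Ts _ rT; have [dx0 _ _] := ode _ rT.
    have h3 := is_derive_gainX 3 (lt0r_neq0 Tr).
    have h1 := is_derive_gainX 1 (lt0r_neq0 Tr).
    apply: (is_derive_eq (is_deriveD (is_deriveM dx0 h3)
      (@is_deriveZ _ _ _ _ (bt / 2) _ _ _ h1))).
    by rewrite /u0 /GRing.scale /=; field; rewrite gt_eqF.
  have Gle : G s <= G 0 by apply: derive_le0_le sT GD _ => r _.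
  have NGle : (- G) s <= (- G) 0.
    by apply: (derive_le0_le (df := fun=> - 0) sT) => [r rT|r _];
      [exact: is_deriveN (GD _ rT)|rewrite oppr0].
  have /eqP : G s = G 0 by apply/eqP; rewrite eq_le Gle /= -lerN2.
  have GE r : G r = x0 r * (T - r)^-1 ^+ 3 + bt / 2 * (T - r)^-1 ^+ 1 by [].
  rewrite !GE subr0 => /eqP eqG.
  have -> : x0 s = (T - s) ^+ 3 * (x0 s * (T - s)^-1 ^+ 3 + bt / 2 * (T - s)^-1 ^+ 1)
      - (T - s) ^+ 2 * (bt / 2) by field; rewrite gt_eqF// Ts.
  by rewrite eqG; field; rewrite gt_eqF.
pose a := x0 0 / T ^+ 3 + bt / (2 * T).
have u0E s : 0 <= s < T -> u0 s = (T - s) * (bt - 3 * (T - s) * a).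
  move=> sT; rewrite /u0 x0E// /a; field.
  by rewrite !gt_eqF// Ts.
have a_le : `|a| <= `|x0 0| / T ^+ 3 + bt / (2 * T).
  apply: (le_trans (ler_normD _ _)); rewrite normrM.
  by rewrite (gtr0_norm (_ : 0 < (T ^+ 3)^-1)) ?invr_gt0 ?exprn_gt0// lerD2l
    gtr0_norm// divr_gt0// mulr_gt0.
pose om s := revdiag n (T - s)^-1 *m xi s.
pose ze s := revdiag n (T - s)^-1 *m (revdiag n (T - s)^-1 *m x s).
pose W s := lyap (om s) (ze s - om s).
have u0g s : 0 <= s < T -> u0 s * (T - s)^-1 ^+ 2 = bt * (T - s)^-1 - 3 * a.
  by move=> sT; rewrite u0E//; field; rewrite gt_eqF// Ts.
have gs s : 0 <= s < T -> 0 < (T - s)^-1 by move=> sT; rewrite invr_gt0 Ts.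
pose K := c1 * `|a|.
have [dW WD Wle] : exists2 dW : R -> R,
    forall s, 0 <= s < T -> is_derive s 1 W (dW s) &
    forall s, 0 <= s < T -> dW s <= (- 3 * (T - s)^-1 + K) * W s.
  pose g s := (T - s)^-1.
  pose f s : 'cV[R]_n := \col_i phi i s (u0 s) (u s) (x s).
  pose dx s := u0 s *: (Amat R n *m x s) + u s *: bvec R n + f s.
  pose dxi s := bt *: (Amat R n *m xi s) + u s *: bvec R n
    + bt *: (Qmat n (g s) *m (cvec R n)^T)
        *m (g s ^+ n.-1 *: (cvec R n *m x s) - cvec R n *m xi s).
  pose dom s := revdiag n (g s) *m dxi s + g s *: (Emat R n *m om s).
  pose dze s := revdiag n (g s) *m (revdiag n (g s) *m dx s
      + g s *: (Emat R n *m (revdiag n (g s) *m x s))) + g s *: (Emat R n *m ze s).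
  exists (fun s => 2 * bf (riccP R n) (om s) (dom s)
      + kappa R n * (2 * bf (invmx (riccQ R n)) (ze s - om s) (dze s - dom s))) => s sT.
    have [_ hx hxi] := ode _ sT.
    have Ts0 : T - s != 0 by rewrite gt_eqF// Ts.
    have vom : is_vderive s om (dom s).
      by apply: is_vderive_revdiag => //; apply: is_derive_vderive; rewrite /dxi /g -gamE.
    have vze : is_vderive s ze (dze s).
      by do 2!apply: is_vderive_revdiag => //; exact: is_derive_vderive.
    have D1 := is_derive_bf (P1_posdef R n).1 vom.
    have D2 := is_derive_bf (Qi_posdef R n).1 (is_vderiveB vze vom).
    exact: is_deriveD D1 (@is_deriveZ _ _ _ _ (kappa R n) _ _ _ D2).
  have zeE : ze s = om s + (ze s - om s) by rewrite addrC subrK.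
  have uE : u s = - bt * ((bvec R n)^T *m Pmat n (g s) *m xi s) ord0 ord0.
    by rewrite /u gamE.
  have domE := scaled_observer (g := g s) bt (x s) (xi s) (gs _ sT).
  have dzeE := scaled_error (x s) (xi s) (f s) (gs _ sT) (u0g _ sT).
  rewrite -uE in domE dzeE.
  have {}domE : dom s = _ := domE.
  have {}dzeE : dze s - dom s = _ := dzeE.
  have hphi : forall i, `|f s i ord0| <= \sum_(j < n | (val j <= val i)%N) c i j * `|x s j ord0|.
    by move=> i; rewrite mxE.
  have sle : T - s <= T by rewrite gerDl oppr_le0; case/andP: sT.
  have hpsi := perturbation_le c_ge0 T_gt0 (Ts _ sT) sle hphi (mulmxA _ _ _) (erefl _).
  rewrite dzeE domE /W /K /c1.
  apply: (lyap_rate n_gt0 a zeE (ltW (gs _ sT)) d0 HC hb1 hb2 hpsi) => //.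
  by rewrite invrK.
have Wt := gronwall_gain tT WD Wle.
pose N := enorm (x 0) + enorm (xi 0).
have N0 : 0 <= N by rewrite addr_ge0// enorm_ge0.
have W0_le : W 0 <= Lambda R n * (1 + 2 * kappa R n) * (m0 + m0 ^+ 2) * N ^+ 2.
  apply: (le_trans (lyap_le n_gt0 _ _)); rewrite -[leRHS]mulrA.
  apply: ler_wpM2l; first by rewrite mulr_ge0 ?(ltW L0)// addr_ge0// mulr_ge0// ltW.
  have gT : 0 <= (T - 0)^-1 <= T^-1 by rewrite subr0 lexx ltW.
  have h1 := revdiag_le (xi 0) gT; have h2 := revdiag_le (x 0) gT.
  have h3 := revdiag_le (revdiag n (T - 0)^-1 *m x 0) gT.
  rewrite -/m0 -!enorm_sqr in h1 h2 h3.
  have h4 : m0 * enorm (revdiag n (T - 0)^-1 *m x 0) ^+ 2 <= m0 * (m0 * enorm (x 0) ^+ 2).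
    by rewrite ler_pM2l.
  rewrite -!enorm_sqr /N.
  apply: (le_trans (lerD h1 (le_trans h3 h4))).
  have p0 := enorm_ge0 (x 0); have q0 := enorm_ge0 (xi 0).
  move: p0 q0; set p := enorm (x 0); set q := enorm (xi 0) => p0 q0.
  have -> : (m0 + m0 ^+ 2) * (p + q) ^+ 2 = m0 * q ^+ 2 + m0 * (m0 * p ^+ 2) +
     (m0 * (p ^+ 2 + 2 * p * q) + m0 ^+ 2 * (q ^+ 2 + 2 * p * q)) by ring.
  rewrite lerDl; do ?[apply: addr_ge0 | apply: mulr_ge0 | apply: exprn_ge0] => //; exact: ltW.
have Kt : K * t <= c1 * (bt / 2) + 2 * (v * `|x0 0| * t).
  have h : `|a| * t <= `|x0 0| / T ^+ 3 * t + bt / 2.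
    apply: (le_trans (ler_wpM2r t0 a_le)); rewrite mulrDl lerD2l.
    have -> : bt / 2 = bt / (2 * T) * T by field; rewrite gt_eqF.
    by apply: ler_wpM2l; [rewrite divr_ge0 ?mulr_ge0 ?ltW|exact: ltW].
  have -> : c1 * (bt / 2) + 2 * (v * `|x0 0| * t) = c1 * (`|x0 0| / T ^+ 3 * t + bt / 2).
    by rewrite /v; field; rewrite gt_eqF.
  by rewrite /K -mulrA ler_pM2l.
have Wt_le : W t <= M * N ^+ 2 * expR (2 * (v * `|x0 0| * t)) * (T - t) ^+ 3.
  apply: (le_trans Wt).
  have -> : M * N ^+ 2 * expR (2 * (v * `|x0 0| * t)) * (T - t) ^+ 3 =
     Lambda R n * (1 + 2 * kappa R n) * (m0 + m0 ^+ 2) * N ^+ 2 * ((T - t) / T) ^+ 3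
      * (expR (c1 * (bt / 2)) * expR (2 * (v * `|x0 0| * t))).
    by rewrite /M; field; rewrite gt_eqF.
  have tauT : 0 <= ((T - t) / T) ^+ 3 by rewrite exprn_ge0// divr_ge0// ltW.
  apply: ler_pM; rewrite ?expR_ge0//.
  - by rewrite mulr_ge0// lyap_ge0.
  - exact: ler_wpM2r.
  - by rewrite -expRD ler_expR.
have gtau : 0 <= T - t <= T by rewrite (ltW tau_gt0) gerDl oppr_le0.
have tauN0 : T - t != 0 by rewrite gt_eqF.
have zeE : om t + (ze t - om t) = ze t by rewrite addrC subrK.
split.
- rewrite x0E//; apply: (le_trans (ler_normB _ _)).
  rewrite mulrDr lerD//.
    rewrite normrM gtr0_norm ?divr_gt0 ?exprn_gt0//.
    by rewrite le_eqVlt; apply/orP; left; apply/eqP; field; rewrite gt_eqF.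
  rewrite ger0_norm// mulr_ge0 ?exprn_ge0 ?divr_ge0 ?mulr_ge0 ?(ltW T_gt0) ?(ltW bt_gt0) ?(ltW tau_gt0)//.
- rewrite u0E// normrM (gtr0_norm tau_gt0) ler_pM2l//.
  apply: (le_trans (ler_normB _ _)); rewrite (gtr0_norm bt_gt0) addrC lerD2r.
  rewrite normrM gtr0_norm ?mulr_gt0//; apply: ler_wpM2l => //.
  by rewrite mulr_ge0// ltW.
- apply: le_sqrt_expR Wt_le; rewrite ?enorm_ge0 ?(ltW B3_gt0) ?(ltW M_gt0)//.
  have xE : x t = revdiag n (T - t) *m (revdiag n (T - t) *m ze t).
    by rewrite /ze !revdiagK.
  rewrite enorm_sqr {1 2}xE.
  apply: (le_trans (revdiag_le _ gtau)); rewrite -/m1.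
  apply: (le_trans (ler_wpM2l (ltW m1_gt0) (revdiag_le _ gtau))); rewrite -/m1.
  rewrite [leLHS]mulrA -expr2 /B3 -[leRHS]mulrA; apply: ler_wpM2l; first by rewrite exprn_ge0// ltW.
  by rewrite -{1 2}zeE; exact: state_le_lyap.
- apply: le_sqrt_expR Wt_le; rewrite ?enorm_ge0 ?(ltW B4_gt0) ?(ltW M_gt0)//.
  have xiE : xi t = revdiag n (T - t) *m om t by rewrite /om revdiagK.
  rewrite enorm_sqr {1 2}xiE.
  apply: (le_trans (revdiag_le _ gtau)); rewrite -/m1 /B4 -mulrA.
  by apply: ler_wpM2l; [exact: ltW|exact: observer_le_lyap].
- have uE : u t = - bt * ((T - t)^-1 * bf (riccP R n) (bvec R n) (om t)).
    by rewrite /u gamE (scaled_input bt (xi t) (gs _ tT)).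
  have s_le : `|bf (riccP R n) (bvec R n) (om t)| <=
      Num.sqrt (B5 * M) * expR (v * `|x0 0| * t) * powR (T - t) (3 / 2) * N.
    apply: le_sqrt_expR Wt_le; rewrite ?(ltW B5_gt0) ?(ltW M_gt0)//.
    by rewrite real_normK ?num_real//; exact: input_le_lyap.
  rewrite uE normrM normrN (gtr0_norm bt_gt0) normrM (gtr0_norm (gs _ tT)).
  rewrite -(powR_half tau_gt0) [leRHS](_ : _ = bt * ((T - t)^-1 *
      (Num.sqrt (B5 * M) * expR (v * `|x0 0| * t) * powR (T - t) (3 / 2) * N))).
    by rewrite ler_pM2l// ler_pM2l// gs.
  by rewrite /N; ring.
Qed.
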